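(* Let $K$ be a field of characteristic zero, $l\in\mathbb{N}$, $P\in L^{(l)}$, and let $(\rho,\sigma)\in\mathfrak{V}_{>0}$ be such that $v_{\rho,\sigma}(P)>0$. If $[P,Q]\in K^\times$ for some $Q\in L^{(l)}$, then there exist $G_0\in K[P,Q]\setminus\{0\}$ and a $(\rho,\sigma)$-homogeneous element $F\in L^{(l)}$ such that $$v_{\rho,\sigma}(F)=\rho+\sigma,\quad [F,\ell_{\rho,\sigma}(P)]=\ell_{\rho,\sigma}(P)\quad\text{and}\quad [\ell_{\rho,\sigma}(G_0),\ell_{\rho,\sigma}(P)]\,F=\ell_{\rho,\sigma}(G_0)\,\ell_{\rho,\sigma}(P).$$ Moreover: (1) If $P,Q\in L=K[x,y]$, then we can take $F\in L$. (2) $\mathrm{st}_{\rho,\sigma}(P)\sim\mathrm{st}_{\rho,\sigma}(F)$ or $\mathrm{st}_{\rho,\sigma}(F)=(1,1)$. (3) $\mathrm{en}_{\rho,\sigma}(P)\sim\mathrm{en}_{\rho,\sigma}(F)$ or $\mathrm{en}_{\rho,\sigma}(F)=(1,1)$. (4) $\mathrm{st}_{\rho,\sigma}(P)\nsim(1,1)\nsim\mathrm{en}_{\rho,\sigma}(P)$. (5) If we define recursively $G_i:=[G_{i-1},P]$, then $[\ell_{\rho,\sigma}(G_i),\ell_{\rho,\sigma}(P)]=0$ for $i\ge1$.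
   Context: $L^{(l)}=K[x^{1/l},x^{-1/l},y]$; $[P,Q]:=\partial_xP\,\partial_yQ-\partial_xQ\,\partial_yP$ for $P,Q\in L^{(l)}$; $K[P,Q]$ is the $K$-subalgebra generated by $P,Q$. $\mathfrak{V}_{>0}=\{(\rho,\sigma)\in\mathbb{Z}^2:\gcd(\rho,\sigma)=1,\ \rho+\sigma>0\}$. For $P=\sum a_{i/l,j}x^{i/l}y^j\ne0$: $\mathrm{Supp}(P)=\{(i/l,j):a_{i/l,j}\neq0\}$, $v_{\rho,\sigma}(i/l,j)=\rho i/l+\sigma j$, $v_{\rho,\sigma}(P)=\max v_{\rho,\sigma}$ over $\mathrm{Supp}(P)$, and $\ell_{\rho,\sigma}(P)$ is the sum of the terms of $P$ attaining this maximum; $v_{\rho,\sigma}(0)=-\infty$, $\ell_{\rho,\sigma}(0)=0$. $P$ is $(\rho,\sigma)$-homogeneous if $P=\ell_{\rho,\sigma}(P)$. The cross product is $(a_1,a_2)\times(b_1,b_2)=a_1b_2-a_2b_1$, and $A\sim B$ means $A\times B=0$. If $\ell_{\rho,\sigma}(P)$ is a monomial, $\mathrm{st}_{\rho,\sigma}(P)=\mathrm{en}_{\rho,\sigma}(P)$ is its exponent; otherwise they are the two endpoints of the segment spanned by $\mathrm{Supp}(\ell_{\rho,\sigma}(P))$, ordered so that $(\rho,\sigma)\times(\mathrm{en}_{\rho,\sigma}(P)-\mathrm{st}_{\rho,\sigma}(P))>0$. *)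

(* Defs.v *)
From HB Require Import structures.
From mathcomp Require Import all_boot all_order all_algebra.
From mathcomp Require Import finmap.
From mathcomp Require Import ring lra.
From mathcomp Require Import boolp classical_sets constructive_ereal.
(* The notations of monalg and constructive_ereal clash. *)
From mathcomp.multinomials Require monalg.
Import -(notations) monalg.

Set Implicit Arguments.
Unset Strict Implicit.
Unset Printing Implicit Defensive.

Import Order.TTheory GRing.Theory Num.Theory.

Local Open Scope fset_scope.
Local Open Scope ring_scope.

(* The exponent (i, j) : int * nat stands for the monomial x^(i/l) y^j.  The
   parameter l does not occur in the carrier; it fixes how an index is read
   as an exponent, hence the derivation d/dx and the valuations below. *)
Definition laurent (K : fieldType) (l : nat) : Type := malg (int * nat)%type K.

HB.instance Definition _ (K : fieldType) (l : nat) :=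
  Choice.copy (laurent K l) (malg (int * nat)%type K).
HB.instance Definition _ (K : fieldType) (l : nat) :=
  GRing.Lmodule.copy (laurent K l) (malg (int * nat)%type K).

Definition mono (K : fieldType) (l : nat) (c : K) (m : int * nat) :
  laurent K l := mkmalgU m c.
Arguments mono {K} l c m.

Section Ring.
Context {K : fieldType} {l : nat}.
Local Notation L := (laurent K l).
Implicit Types (P Q : L) (m n : int * nat).

(* The ring structure of the library on {malg K[M]} asks that the monoid M
   have no unit but 1, which fails for int * nat; hence a separate product. *)
Definition lmul P Q : L :=
  \sum_(m <- msupp P) \sum_(n <- msupp Q)
    mono l (mcoeff m P * mcoeff n Q) (m + n).
Definition lone : L := mono l 1 0.

Lemma lcoeff_sum (I : Type) (r : seq I) (p : pred I) (F : I -> L) m :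
  mcoeff m (\sum_(i <- r | p i) F i) = \sum_(i <- r | p i) mcoeff m (F i).
Proof. exact: (raddf_sum (@mcoeff (int * nat)%type K m)). Qed.

Lemma laurentP P Q : (forall m, mcoeff m P = mcoeff m Q) -> P = Q.
Proof. by move=> h; apply/malgP. Qed.

Lemma mono0 m : mono l (0 : K) m = 0.
Proof. exact: (@monalgU0 (int * nat)%type K m). Qed.

Lemma monoD m (a b : K) : mono l (a + b) m = mono l a m + mono l b m.
Proof. exact: (@monalgUD (int * nat)%type K m). Qed.

Lemma laurentE P : P = \sum_(m <- msupp P) mono l (mcoeff m P) m.
Proof. exact: (@monalgE (int * nat)%type K P). Qed.

Lemma lmulw (d1 d2 : {fset (int * nat)%type}) P Q :
  msupp P `<=` d1 -> msupp Q `<=` d2 ->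
  lmul P Q = \sum_(m <- d1) \sum_(n <- d2)
    mono l (mcoeff m P * mcoeff n Q) (m + n).
Proof.
move=> le1 le2; rewrite /lmul (big_fset_incl _ le1) /=.
  apply/eq_bigr=> m _; apply/big_fset_incl => // n _ /mcoeff_outdom ->.
  by rewrite mulr0 mono0.
move=> m _ /mcoeff_outdom Pm.
by rewrite big1 // => n _; rewrite Pm mul0r mono0.
Qed.

Lemma lmulUU (a b : K) m n :
  lmul (mono l a m) (mono l b n) = mono l (a * b) (m + n).
Proof.
by rewrite (lmulw msuppU_le msuppU_le) !big_seq_fset1 !mcoeffUU.
Qed.

Lemma lmulC : commutative lmul.
Proof.
move=> P Q; rewrite /lmul exchange_big /=; apply: eq_bigr => n _.
by apply: eq_bigr => m _; rewrite mulrC addrC.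
Qed.

Lemma lmulDl : left_distributive lmul +%R.
Proof.
move=> P Q R.
have leP := fsubsetUl (msupp P) (msupp Q).
have leQ := fsubsetUr (msupp P) (msupp Q).
rewrite (lmulw leP (fsubset_refl _)) (lmulw leQ (fsubset_refl _)).
rewrite (lmulw (msuppD_le P Q) (fsubset_refl _)) -big_split /=.
apply/eq_bigr=> m _; rewrite -big_split /=; apply/eq_bigr=> n _.
by rewrite mcoeffD mulrDl monoD.
Qed.

Lemma lmul0l : left_zero 0 lmul.
Proof. by move=> P; rewrite /lmul msupp0 big_seq_fset0. Qed.

Lemma lmul_suml (I : Type) (r : seq I) (F : I -> L) Q :
  lmul (\sum_(i <- r) F i) Q = \sum_(i <- r) lmul (F i) Q.
Proof.
exact: (big_morph (lmul^~ Q) (fun _ _ => lmulDl _ _ _) (lmul0l _)).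
Qed.

Lemma lmul_sumr (I : Type) (r : seq I) (F : I -> L) Q :
  lmul Q (\sum_(i <- r) F i) = \sum_(i <- r) lmul Q (F i).
Proof. by rewrite lmulC lmul_suml; apply: eq_bigr => i _; rewrite lmulC. Qed.

Lemma lmulA : associative lmul.
Proof.
move=> P Q R; rewrite (laurentE P) (laurentE Q) (laurentE R).
set p := fun m => mono l (mcoeff m P) m.
set q := fun m => mono l (mcoeff m Q) m.
set r := fun m => mono l (mcoeff m R) m.
transitivity (\sum_(m <- msupp P) \sum_(n <- msupp Q) \sum_(k <- msupp R)
  lmul (p m) (lmul (q n) (r k))).
  rewrite lmul_suml; apply: eq_bigr => m _.
  rewrite lmul_suml lmul_sumr; apply: eq_bigr => n _.
  by rewrite !lmul_sumr.
rewrite !lmul_suml; apply: eq_bigr => m _.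
rewrite [lmul (p m) _]lmul_sumr lmul_suml; apply: eq_bigr => n _.
rewrite lmul_sumr; apply: eq_bigr => k _.
by rewrite !lmulUU mulrA addrA.
Qed.

Lemma lmul1l : left_id lone lmul.
Proof.
move=> P; rewrite [in LHS](laurentE P) [RHS](laurentE P) lmul_sumr.
by apply: eq_bigr => m _; rewrite lmulUU mul1r add0r.
Qed.

Lemma lone_neq0 : lone != 0.
Proof.
apply/eqP => /(congr1 (@mcoeff (int * nat)%type K 0)).
by rewrite mcoeffUU mcoeff0 => /eqP; rewrite oner_eq0.
Qed.

HB.instance Definition _ := GRing.Zmodule_isComNzRing.Build L
  lmulA lmulC lmul1l lmulDl lone_neq0.

Lemma lscaleAl (c : K) P Q : c *: (P * Q) = (c *: P) * Q.
Proof.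
rewrite [RHS](lmulw (msuppZ_le c P) (fsubset_refl _)) scaler_sumr.
apply: eq_bigr => m _; rewrite scaler_sumr; apply: eq_bigr => n _.
apply: laurentP => k.
by rewrite mcoeffZ !mcoeffU mcoeffZ mulrnAr mulrA.
Qed.

HB.instance Definition _ := GRing.Lmodule_isLalgebra.Build K L lscaleAl.
HB.instance Definition _ := GRing.Lalgebra_isComAlgebra.Build K L.

Lemma monoM (a b : K) m n : mono l a m * mono l b n = mono l (a * b) (m + n).
Proof. exact: lmulUU. Qed.

Definition dx P : L :=
  \sum_(m <- msupp P)
    mono l (mcoeff m P * (m.1%:~R / l%:R)) (m.1 - l%:Z, m.2).
Definition dy P : L :=
  \sum_(m <- msupp P) mono l (mcoeff m P * m.2%:R) (m.1, m.2.-1).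

Definition bracket P Q : L := dx P * dy Q - dy P * dx Q.

(* G lies in K[P, Q], the smallest K-subalgebra containing P and Q. *)
Definition in_gen_alg P Q (G : L) : Prop :=
  forall S : {pred L}, subalg_closed S -> P \in S -> Q \in S -> G \in S.

Definition expo m : rat * rat := (m.1%:~R / l%:R, m.2%:R).

Definition Supp P : {fset (rat * rat)%type} := [fset expo m | m in msupp P].

(* Membership in the subring K[x, y]. *)
Definition in_Kxy P : Prop := forall p, p \in Supp P -> p.1 \is a Num.nat.

End Ring.
Arguments expo l m : clear implicits.

Definition ratdir (d : int * int) : rat * rat := (d.1%:~R, d.2%:~R).

Definition dirpos (d : int * int) : Prop := coprimez d.1 d.2 /\ 0 < d.1 + d.2.

Definition cross (a b : rat * rat) : rat := a.1 * b.2 - a.2 * b.1.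

Definition aligned (a b : rat * rat) : Prop := cross a b = 0.

Definition vpt (d : int * int) (p : rat * rat) : rat :=
  d.1%:~R * p.1 + d.2%:~R * p.2.

Definition segment (a b p : rat * rat) : Prop :=
  exists2 t : rat, 0 <= t <= 1 &
    p = ((1 - t) * a.1 + t * b.1, (1 - t) * a.2 + t * b.2).

Section Valuation.
Context {K : fieldType} {l : nat}.
Local Notation L := (laurent K l).
Implicit Types (P : L) (d : int * int).

Definition vdeg d P : \bar rat := \big[maxe/-oo%E]_(p <- Supp P) (vpt d p)%:E.

Definition lead d P : L :=
  \sum_(m <- msupp P | (vpt d (expo l m))%:E == vdeg d P)
    mono l (mcoeff m P) m.

Definition homogeneous d P : Prop := P = lead d P.

Definition endpoints d P (se : (rat * rat) * (rat * rat)) : Prop :=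
  let S := Supp (lead d P) in
  if #|` S | == 1%N then S = [fset se.1] /\ se.2 = se.1
  else [/\ se.1 \in S, se.2 \in S,
           forall p, p \in S -> segment se.1 se.2 p &
           0 < cross (ratdir d) (se.2 - se.1)].

(* For P != 0 the endpoints exist and are unique: st_enP and endpoints_uniq;
   the default value is only used for P = 0. *)
Definition st_en d P : (rat * rat) * (rat * rat) :=
  xget ((0, 0), (0, 0)) (endpoints d P).
Definition st d P := (st_en d P).1.
Definition en d P := (st_en d P).2.

End Valuation.

Section Endpoints.
Context {K : fieldType} {l : nat}.
Local Notation L := (laurent K l).
Implicit Types (P : L) (d : int * int).

Lemma ex_seq_min (T : eqType) (f : T -> rat) (s : seq T) : s != [::] ->
  exists2 x, x \in s & forall y, y \in s -> f x <= f y.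
Proof.
elim: s => // a [|b s] IH _.
  by exists a => [|y]; rewrite ?mem_head // inE => /eqP ->.
have [//|x xs hx] := IH.
have [le_ax|lt_xa] := leP (f a) (f x).
  exists a; first exact: mem_head.
  move=> y; rewrite inE => /predU1P[->//|/hx]; exact: le_trans.
exists x; first by rewrite inE xs orbT.
by move=> y; rewrite inE => /predU1P[->|/hx//]; exact: ltW.
Qed.

Lemma lead_coeff d P m :
  mcoeff m (lead d P) =
    if (vpt d (expo l m))%:E == vdeg d P then mcoeff m P else 0.
Proof.
rewrite /lead lcoeff_sum.
have E (n : int * nat) : mcoeff m (mono l (mcoeff n P) n) = mcoeff n P *+ (n == m).
  exact: mcoeffU.
have [mP|mP] := boolP (m \in msupp P); last first.
  rewrite (mcoeff_outdom mP) if_same big_seq_cond big1 // => n /andP[nP _].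
  by rewrite E; case: eqVneq nP mP => [->->|].
rewrite big_mkcond (big_fsetD1 m) //= E eqxx.
rewrite big_seq big1 => [|n]; first by rewrite addr0.
by rewrite in_fsetD1 E => /andP[/negPf -> _]; rewrite mulr0n if_same.
Qed.

Lemma Supp_leadP d P p : p \in Supp (lead d P) ->
  (vpt d p)%:E = vdeg d P.
Proof.
case/imfsetP => m /=; rewrite -mcoeff_neq0 lead_coeff.
by case: ifP => [/eqP h _ ->|_]; rewrite ?eqxx.
Qed.

Lemma vdeg_le d P p : p \in Supp P -> ((vpt d p)%:E <= vdeg d P)%E.
Proof. by move=> pP; rewrite /vdeg (big_fsetD1 p) //= le_max lexx. Qed.

Lemma enum_fset_neq0 (T : choiceType) (S : {fset T}) x :
  x \in S -> enum_fset S != [::].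
Proof.
by move=> xS; rewrite -size_eq0 cardfs_eq0; apply/fset0Pn; exists x.
Qed.

Lemma Supp_lead_neq0 d P : P != 0 -> enum_fset (Supp (lead d P)) != [::].
Proof.
move=> P0; have [m0 m0P] : exists m, m \in msupp P.
  have /fset0Pn [m mP] : msupp P != fset0; last by exists m.
  apply: contraNneq P0 => s0; apply/eqP; apply: laurentP => m.
  by rewrite mcoeff0 mcoeff_outdom // s0.
have ne : enum_fset (msupp P) != [::] by exact: enum_fset_neq0 m0P.
have [m mP mM] := ex_seq_min (fun m => - vpt d (expo l m)) ne.
have vm : (vpt d (expo l m))%:E = vdeg d P.
  apply/le_anti/andP; split; first by apply/vdeg_le/in_imfset.
  rewrite /vdeg big_seq; elim/big_ind: _ => [|x y hx hy|p].
  - exact: leNye.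
  - by rewrite ge_max hx.
  by case/imfsetP => n /= nP ->; rewrite lee_fin -lerN2; exact: mM.
apply: (@enum_fset_neq0 _ _ (expo l m)).
by apply/in_imfset; rewrite /= -mcoeff_neq0 lead_coeff vm eqxx mcoeff_neq0.
Qed.

Lemma vpt_cross_inj d (p q : rat * rat) : d != (0, 0) ->
  vpt d p = vpt d q -> cross (ratdir d) p = cross (ratdir d) q -> p = q.
Proof.
case: d p q => [r s] [a b] [a' b']; rewrite /vpt /cross /= => d0 e1 e2.
have n0 : (r%:~R ^+ 2 + s%:~R ^+ 2 : rat) != 0.
  apply: contra d0; rewrite paddr_eq0 ?sqr_ge0 // !sqrf_eq0 !intr_eq0.
  by case/andP => /eqP -> /eqP ->.
have ea : (r%:~R ^+ 2 + s%:~R ^+ 2) * (a - a') = 0 :> rat.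
  transitivity (r%:~R * ((r%:~R * a + s%:~R * b) - (r%:~R * a' + s%:~R * b'))
    - s%:~R * ((r%:~R * b - s%:~R * a) - (r%:~R * b' - s%:~R * a')) : rat).
    by ring.
  by rewrite e1 e2 !subrr !mulr0 subrr.
have eb : (r%:~R ^+ 2 + s%:~R ^+ 2) * (b - b') = 0 :> rat.
  transitivity (s%:~R * ((r%:~R * a + s%:~R * b) - (r%:~R * a' + s%:~R * b'))
    + r%:~R * ((r%:~R * b - s%:~R * a) - (r%:~R * b' - s%:~R * a')) : rat).
    by ring.
  by rewrite e1 e2 !subrr !mulr0 addr0.
move/eqP: ea; rewrite mulf_eq0 (negPf n0) /= subr_eq0 => /eqP ->.
by move/eqP: eb; rewrite mulf_eq0 (negPf n0) /= subr_eq0 => /eqP ->.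
Qed.

Lemma endpoints_ex d P : d != (0, 0) -> P != 0 -> exists se, endpoints d P se.
Proof.
move=> d0 P0; rewrite /endpoints /=; set S := Supp (lead d P).
have ne : enum_fset S != [::] by exact: Supp_lead_neq0.
have [/cardfs1P[p ->]|S1] := boolP (#|` S | == 1%N); first by exists (p, p).
have [s sS smin] := ex_seq_min (cross (ratdir d)) ne.
have [e eS emax] := ex_seq_min (fun p => - cross (ratdir d) p) ne.
have same p q : p \in S -> q \in S -> vpt d p = vpt d q.
  by move=> /Supp_leadP hp /Supp_leadP hq; apply: EFin_inj; rewrite hp hq.
have lt_se : cross (ratdir d) s < cross (ratdir d) e.
  rewrite ltNge; apply/negP => le_es; case/negP: S1.
  apply/cardfs1P; exists s; apply/fsetP => p; rewrite in_fset1.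
  apply/idP/eqP => [pS|->//]; apply: (vpt_cross_inj d0); first exact: same.
  apply/le_anti; rewrite smin // andbT.
  by apply: le_trans le_es; rewrite -lerN2; exact: emax.
exists (s, e); split => //=; last first.
  by move: lt_se; rewrite /cross /=; lra.
move=> p pS; set w := cross (ratdir d) e - cross (ratdir d) s.
have w0 : 0 < w by rewrite subr_gt0.
have wn : w != 0 by rewrite gt_eqF.
pose t := (cross (ratdir d) p - cross (ratdir d) s) / w.
have tw : t * w = cross (ratdir d) p - cross (ratdir d) s by rewrite divfK.
exists t.
  rewrite divr_ge0 ?subr_ge0 ?smin ?(ltW w0) //= ler_pdivrMr // mul1r.
  by rewrite lerD2r -lerN2 emax.
have vs := same _ _ sS pS; have ve := same _ _ eS pS.
apply: (vpt_cross_inj d0).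
  transitivity ((1 - t) * vpt d s + t * vpt d e); last by rewrite /vpt /=; ring.
  by rewrite vs ve; ring.
transitivity (cross (ratdir d) s + t * w); first by rewrite tw; ring.
by rewrite /w /cross /=; ring.
Qed.

Lemma st_enP d P : d != (0, 0) -> P != 0 -> endpoints d P (st d P, en d P).
Proof.
move=> d0 P0; have [se h] := endpoints_ex d0 P0.
by rewrite -surjective_pairing; apply: (xgetI _ h).
Qed.

Lemma endpoints_uniq d P se se' :
  d != (0, 0) -> endpoints d P se -> endpoints d P se' -> se = se'.
Proof.
move=> d0; rewrite /endpoints; case: se se' => [s e] [s' e'] /=.
set S := Supp (lead d P); case: ifP => _.
  by move=> [-> ->] [/fset1_inj -> ->].
move=> [sS eS h c] [s'S e'S h' c'].
have same p q : p \in S -> q \in S -> vpt d p = vpt d q.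
  by move=> /Supp_leadP hp /Supp_leadP hq; apply: EFin_inj; rewrite hp hq.
have bnd a b p : 0 < cross (ratdir d) (b - a) -> segment a b p ->
    cross (ratdir d) a <= cross (ratdir d) p <= cross (ratdir d) b.
  rewrite /cross /= => ab [t /andP[t0 t1] ->] /=.
  by apply/andP; split; nra.
have /andP[a1 a2] := bnd _ _ _ c (h _ s'S).
have /andP[a3 a4] := bnd _ _ _ c (h _ e'S).
have /andP[b1 b2] := bnd _ _ _ c' (h' _ sS).
have /andP[b3 b4] := bnd _ _ _ c' (h' _ eS).
congr pair; apply: (vpt_cross_inj d0); try exact: same.
  by apply/le_anti/andP.
by apply/le_anti/andP.
Qed.

End Endpoints.

(* Main.v *)
Require Import Defs.
From mathcomp Require Import all_boot all_order all_algebra.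
From mathcomp Require Import constructive_ereal.
From mathcomp Require Import finmap boolp.
From mathcomp Require Import ring lra zify.
From mathcomp.multinomials Require monalg.
Import -(notations) monalg.

(* With D = [-, P], some G in K[P, Q] has [l(G), l(P)] <> 0: otherwise each
   weight would carry at most one leading form of K[P, Q] up to a scalar, whereas
   K[P, Q] is a polynomial ring in two variables.  As D is nilpotent on G, let G0
   be the last iterate of G with this property, and put p = l(P), g = l(G0) and
   h = [g, p], so that [h, p] = 0.  Then F = g p / h solves [F, p] = p.  To see that h
   divides g p, write homogeneous elements as a monomial times a polynomial in
   one variable z, z being the primitive monomial on the line of exponents, and
   compare the multiplicities of p, g, h at an irreducible polynomial q <> z: the
   equations for [g, p] and [h, p] force mult h <= mult g + mult p.  Finally (2), (3),
   (4) and the polynomiality of F come from the extreme monomials u of F and m of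
   p: either u x m = 0, or u + m - (1, 1) = m. *)

Set Implicit Arguments.
Unset Strict Implicit.
Unset Printing Implicit Defensive.

Import Order.TTheory GRing.Theory Num.Theory.

Local Open Scope ring_scope.

(** The equation [[h, p] = 0] holds because [h], being nonzero, is the leading form of the next
    iterate [[G0, P]]. Bracketing [h F = g p] with [p] then gives [h [F, p] = [g, p] p = h p], and
    [h] cancels. The obstacle is the division. The equations do not control the multiplicity at [z],
    since [z] divides its own image under [z d/dz]; so each polynomial is normalised to have a
    nonzero constant term, the power of [z] going into the monomial factor. The monomial factor of
    [F] must then have a natural y-exponent, because only [x] is invertible; this takes a separate
    argument with weights. *)

Definition crossm (m n : int * nat) : int := m.1 * n.2%:Z - m.2%:Z * n.1.

(** This makes the truncated predecessor in [br_mon] harmless: where it truncates, the coefficient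
    is zero. *)
Lemma crossm0 m n : (m.2 + n.2 = 0)%N -> crossm m n = 0.
Proof.
by rewrite /crossm => /eqP; rewrite addn_eq0 => /andP[/eqP-> /eqP->]; ring.
Qed.

(* Unification on [laurent K l] tends to unfold its product down to [malg];
   the ring is therefore handled through this interface. *)
Record model (K : fieldType) (l : nat) := Model {
  car :> comAlgType K;
  cf : int * nat -> car -> K;
  mon : K -> int * nat -> car;
  supp : car -> seq (int * nat);
  br : car -> car -> car;
  cfD : forall m, {morph cf m : A B / A + B};
  cfZ : forall m c A, cf m (c *: A) = c * cf m A;
  cfP : forall A B, (forall m, cf m A = cf m B) -> A = B;
  cf_mon : forall a m n, cf n (mon a m) = a *+ (m == n);
  monE : forall A, A = \sum_(m <- supp A) mon (cf m A) m;
  monM : forall a b m n, mon a m * mon b n = mon (a * b) (m + n);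
  mon1 : mon 1 0 = 1;
  brDl : forall A B C, br (A + B) C = br A C + br B C;
  brDr : forall A B C, br A (B + C) = br A B + br A C;
  br_mon : forall a m b n, br (mon a m) (mon b n) =
    mon (a * b * ((crossm m n)%:~R / l%:R)) (m.1 + n.1 - l%:Z, (m.2 + n.2)%N.-1)
}.

(** * Supports and the bracket *)

Section Support.
Context {K : fieldType} {l : nat} {M : model K l}.
Local Notation mon := (@mon K l M).
Local Notation cf := (@cf K l M).
Local Notation br := (@br K l M).
Implicit Types (A B C : M) (m n : int * nat) (S : int * nat -> Prop).

Lemma cf0 m : cf m 0 = 0.
Proof. by have := cfZ m 0 (0 : M); rewrite scale0r mul0r. Qed.

Lemma cfN m A : cf m (- A) = - cf m A.
Proof. by rewrite -scaleN1r cfZ mulN1r. Qed.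

Lemma cfB m A B : cf m (A - B) = cf m A - cf m B.
Proof. by rewrite cfD cfN. Qed.

Lemma mon0 m : mon 0 m = 0.
Proof. by apply: cfP => n; rewrite cf_mon mul0rn cf0. Qed.

Lemma monD m a b : mon (a + b) m = mon a m + mon b m.
Proof. by apply: cfP => n; rewrite cfD !cf_mon mulrnDl. Qed.

Lemma monZ m a b : a *: mon b m = mon (a * b) m.
Proof. by apply: cfP => n; rewrite cfZ !cf_mon mulrnAr. Qed.

Lemma mon_eq0 a m : (mon a m == 0) = (a == 0).
Proof.
apply/eqP/eqP => [e|->]; last exact: mon0.
by have := cf_mon M a m m; rewrite e eqxx cf0.
Qed.

Lemma neq0_cf A : A != 0 -> exists m, cf m A != 0.
Proof.
move=> A0; apply: contrapT => h; case/eqP: A0; apply: cfP => m.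
by rewrite cf0; apply: contrapT => /eqP hm; apply: h; exists m.
Qed.

Definition supported S A := forall m, cf m A != 0 -> S m.

Lemma sup_ind S (Pr : M -> Prop) A : supported S A ->
  Pr 0 -> (forall B C, Pr B -> Pr C -> Pr (B + C)) ->
  (forall a m, S m -> Pr (mon a m)) -> Pr A.
Proof.
move=> SA P0 PD P1; rewrite (monE A); elim/big_ind: _ => // m _.
by have [->|/SA] := eqVneq (cf m A) 0; [rewrite mon0 | exact: P1].
Qed.

Lemma model_ind (Pr : M -> Prop) A : (forall a m, Pr (mon a m)) ->
  (forall B C, Pr B -> Pr C -> Pr (B + C)) -> Pr A.
Proof.
move=> P1 PD; apply: (@sup_ind (fun=> True)) => //.
by rewrite -(mon0 0).
Qed.

Lemma sup0 S : supported S 0.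
Proof. by move=> m; rewrite cf0 eqxx. Qed.

Lemma supD S A B : supported S A -> supported S B -> supported S (A + B).
Proof.
move=> hA hB m; rewrite cfD.
have [->|/hA//] := eqVneq (cf m A) 0.
by rewrite add0r => /hB.
Qed.

Lemma supZ S c A : supported S A -> supported S (c *: A).
Proof.
by move=> hA m; rewrite cfZ mulf_eq0 negb_or => /andP[_ /hA].
Qed.

Lemma supN S A : supported S A -> supported S (- A).
Proof. by rewrite -scaleN1r; exact: supZ. Qed.

Lemma supB S A B : supported S A -> supported S B -> supported S (A - B).
Proof. by move=> hA hB; apply: supD => //; exact: supN. Qed.

Lemma sup_mon S a m : S m -> supported S (mon a m).
Proof.
move=> Sm n; rewrite cf_mon.
by case: (eqVneq m n) => [<-|_]; rewrite ?mulr0n ?eqxx.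
Qed.

Lemma supW S S' A : (forall m, S m -> S' m) -> supported S A -> supported S' A.
Proof. by move=> h hA m /hA/h. Qed.

Lemma sup_contra S S' A :
  (forall m, S m -> S' m -> False) -> supported S A -> supported S' A -> A = 0.
Proof.
move=> h hA hA'; apply: contrapT => /eqP/neq0_cf[m mA].
exact: h (hA _ mA) (hA' _ mA).
Qed.

Lemma supM S S' S'' A B :
  (forall m n, S m -> S' n -> S'' (m + n)) ->
  supported S A -> supported S' B -> supported S'' (A * B).
Proof.
move=> h hA hB; apply: (sup_ind (Pr := fun A => supported S'' (A * B)) hA) => [|C D hC hD|a m Sm].
- by rewrite mul0r; exact: sup0.
- by rewrite mulrDl; exact: supD.
apply: (sup_ind (Pr := fun B => supported S'' (mon a m * B)) hB) => [|C D hC hD|b n Sn].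
- by rewrite mulr0; exact: sup0.
- by rewrite mulrDr; exact: supD.
by rewrite monM; apply: sup_mon; exact: h.
Qed.

Lemma br0l A : br 0 A = 0.
Proof. by apply: (addrI (br 0 A)); rewrite -brDl !addr0. Qed.

Lemma br0r A : br A 0 = 0.
Proof. by apply: (addrI (br A 0)); rewrite -brDr !addr0. Qed.

Lemma brZl c A B : br (c *: A) B = c *: br A B.
Proof.
elim/model_ind: A => [a m|A A' e e']; last by rewrite scalerDr !brDl e e' scalerDr.
elim/model_ind: B => [b n|B B' e e']; last by rewrite !brDr e e' scalerDr.
by rewrite monZ !br_mon monZ !mulrA.
Qed.

Lemma brC A B : br A B = - br B A.
Proof.
elim/model_ind: A => [a m|A A' e e']; last by rewrite brDl brDr e e' opprD.
elim/model_ind: B => [b n|B B' e e']; last by rewrite brDl brDr e e' opprD.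
rewrite !br_mon -scaleN1r monZ [n.1 + _]addrC [(n.2 + _)%N]addnC.
congr (mon _ _); have -> : crossm m n = - crossm n m by rewrite /crossm; ring.
by rewrite rmorphN /=; ring.
Qed.

Lemma brNl A B : br (- A) B = - br A B.
Proof. by rewrite -scaleN1r brZl scaleN1r. Qed.

Lemma brBl A B C : br (A - B) C = br A C - br B C.
Proof. by rewrite brDl brNl. Qed.

Lemma brNr A B : br A (- B) = - br A B.
Proof. by rewrite brC brNl -brC. Qed.

Lemma brBr A B C : br A (B - C) = br A B - br A C.
Proof. by rewrite brDr brNr. Qed.

Lemma brMl A B C : br (A * B) C = A * br B C + br A C * B.
Proof.
elim/model_ind: A => [a m|A A' e e']; last first.
  by rewrite mulrDl !brDl e e' !mulrDl; ring.
elim/model_ind: B => [b n|B B' e e']; last first.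
  by rewrite mulrDr !brDl e e' !mulrDr; ring.
elim/model_ind: C => [c k|C C' e e']; last first.
  by rewrite !brDr e e'; ring.
rewrite !(monM, br_mon) /=.
set q := (m.1 + n.1 + k.1 - l%:Z, (m.2 + n.2 + k.2)%N.-1).
have -> : mon (a * (b * c * ((crossm n k)%:~R / l%:R)))
    (m + (n.1 + k.1 - l%:Z, (n.2 + k.2)%N.-1)) =
  mon (a * (b * c * ((crossm n k)%:~R / l%:R))) q.
  have [e|nk] := posnP (n.2 + k.2)%N.
    by rewrite (crossm0 e) mul0r !mulr0 !mon0.
  by congr (mon _ _); rewrite /q; congr pair => /=; [ring | lia].
have -> : mon (a * c * ((crossm m k)%:~R / l%:R) * b)
    ((m.1 + k.1 - l%:Z, (m.2 + k.2)%N.-1) + n) =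
  mon (a * c * ((crossm m k)%:~R / l%:R) * b) q.
  have [e|nk] := posnP (m.2 + k.2)%N.
    by rewrite (crossm0 e) mul0r !(mulr0, mul0r) !mon0.
  by congr (mon _ _); rewrite /q; congr pair => /=; [ring | lia].
rewrite -monD; congr (mon _ _).
have -> : crossm (m + n) k = crossm n k + crossm m k.
  by rewrite /crossm /= PoszD; ring.
by rewrite rmorphD /=; ring.
Qed.

Lemma brMr A B C : br A (B * C) = B * br A C + br A B * C.
Proof. by rewrite brC brMl opprD -mulrN -mulNr -!brC. Qed.

Lemma brAA A : 2 *: br A A = 0.
Proof. by rewrite scaler_nat mulr2n {1}brC addNr. Qed.

(** Bracketing monomials shifts the sum of the exponents by minus the exponent of [xy]; the relation
    is written additively because y-exponents are natural numbers. *)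
Lemma sup_br S S' S'' A B :
  (forall m n k, S m -> S' n -> k + (l%:Z, 1%N) = m + n -> S'' k) ->
  supported S A -> supported S' B -> supported S'' (br A B).
Proof.
move=> h hA hB; apply: (sup_ind (Pr := fun A => supported S'' (br A B)) hA) => [|C D hC hD|a m Sm].
- by rewrite br0l; exact: sup0.
- by rewrite brDl; exact: supD.
apply: (sup_ind (Pr := fun B => supported S'' (br (mon a m) B)) hB) => [|C D hC hD|b n Sn].
- by rewrite br0r; exact: sup0.
- by rewrite brDr; exact: supD.
rewrite br_mon; have [mn|mn] := posnP (m.2 + n.2)%N.
  by rewrite (crossm0 mn) mul0r mulr0 mon0; exact: sup0.
apply: sup_mon; apply: (h m n) => //; congr pair => /=; first by rewrite subrK.
by rewrite -[RHS](prednK mn); exact: addn1.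
Qed.

End Support.

(** * Leading forms for integer weights *)

Section Tops.
Context {K : fieldType} {l : nat} {M : model K l}.
Local Notation mon := (@mon K l M).
Local Notation cf := (@cf K l M).
Local Notation br := (@br K l M).
Implicit Types (A B C T U : M) (m n k : int * nat) (d : int * int) (v : int).

(** This is [l] times the rational weight [vpt d (expo l m)], which keeps all weights integral. *)
Definition wt d m : int := d.1 * m.1 + d.2 * (l%:Z * m.2%:Z).
Definition wxy d : int := wt d (l%:Z, 1%N).
Definition homw d v A := supported (fun m => wt d m = v) A.
Definition below d v A := supported (fun m => wt d m < v) A.
(** [T] is the leading form of [A] and [v] its weight. As a relation it passes through products and
    brackets without computing any maximum, and it excludes [A = 0]. *)
Definition tops d v A T := [/\ homw d v T, T != 0 & below d v (A - T)].

Lemma wtD d m n : wt d (m + n) = wt d m + wt d n.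
Proof. by rewrite /wt /= PoszD; ring. Qed.

Lemma sup_split (S : pred (int * nat)) A : exists T R,
  [/\ A = T + R, supported S T & supported (fun m => ~~ S m) R].
Proof.
elim/(@model_ind K l M): A => [a m|_ _ [T [R [-> h1 h2]]] [T' [R' [-> h1' h2']]]].
  case: (boolP (S m)) => Sm.
    exists (mon a m), 0; rewrite addr0; split=> //; [exact: sup_mon|exact: sup0].
  exists 0, (mon a m); rewrite add0r; split=> //; [exact: sup0|exact: sup_mon].
exists (T + T'), (R + R'); rewrite addrACA; split=> //; exact: supD.
Qed.

Lemma cf_supp m A : cf m A != 0 -> m \in supp A.
Proof.
apply: contraR => mA; rewrite [X in cf m X](monE A).
rewrite (big_morph (cf m) (@cfD _ _ M m) (cf0 _)) big_seq big1 // => n nA.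
by rewrite cf_mon; case: eqVneq nA mA => [->->|].
Qed.

Lemma tops_ex d A : A != 0 -> exists v T, tops d v A T.
Proof.
move=> A0; have [m0 m0A] := neq0_cf A0.
(* [supp] is constrained only by [monE], so it may list exponents whose coefficient is zero. *)
have ne : [seq m <- supp A | cf m A != 0] != [::].
  have : m0 \in [seq m <- supp A | cf m A != 0] by rewrite mem_filter m0A cf_supp.
  by case: [seq _ <- _ | _].
have [m mA mmax] := ex_seq_min (fun m => - (wt d m)%:~R : rat) ne.
have [T [R [AE hT hR]]] := sup_split (fun n => wt d n == wt d m) A.
have hT' : homw d (wt d m) T by apply: supW hT => n /eqP.
have RE n : wt d n != wt d m -> cf n R = cf n A.
  move=> nm; rewrite AE cfD; have [->|/hT] := eqVneq (cf n T) 0; last by rewrite (negPf nm).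
  by rewrite add0r.
exists (wt d m), T; split=> //.
- apply/eqP => T0; move: mA; rewrite mem_filter AE T0 add0r => /andP[/hR].
  by rewrite eqxx.
- rewrite {1}AE [T + R]addrC addrK => n nR; have nm := hR _ nR.
  rewrite lt_neqAle nm /= -(ler_int rat) -lerN2; apply: mmax.
  by rewrite mem_filter -RE // nR cf_supp // -RE.
Qed.

Lemma tops_le d v v' A T T' : tops d v A T -> tops d v' A T' -> v <= v'.
Proof.
case=> hT /neq0_cf[m mT] hR [hT' _ hR'].
have e := hT _ mT.
have R0 : cf m (A - T) = 0.
  by apply: contrapT => /eqP/hR; rewrite e ltxx.
have mA : cf m A != 0 by move: R0; rewrite cfB => /subr0_eq ->.
have [z|/hR'] := eqVneq (cf m (A - T')) 0; last by rewrite e => /ltW.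
by move: z; rewrite cfB => /subr0_eq z; rewrite -e (hT' m) // -z.
Qed.

Lemma tops_uniq d v v' A T T' : tops d v A T -> tops d v' A T' -> v = v' /\ T = T'.
Proof.
move=> h h'; have e : v = v'.
  by apply/le_anti; rewrite (tops_le h h') (tops_le h' h).
split=> //; subst v'; case: h h' => hT _ hR [hT' _ hR'].
apply/eqP; rewrite -subr_eq0; apply/eqP.
apply: (@sup_contra _ _ _ (fun m => wt d m = v) (fun m => wt d m < v)).
- by move=> m ->; rewrite ltxx.
- exact: supB.
by have := supB hR' hR; rewrite opprB addrC subrKA addrC.
Qed.

Lemma tops_id d v T : homw d v T -> T != 0 -> tops d v T T.
Proof. by move=> hT T0; split=> //; rewrite subrr; exact: sup0. Qed.

Lemma tops_neq0 d v A T : tops d v A T -> A != 0.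
Proof.
case=> hT T0 hR; apply: contra_neq T0 => A0; move: hR; rewrite A0 sub0r => hR.
apply: (@sup_contra _ _ _ (fun m => wt d m = v) (fun m => wt d m < v)) => //.
- by move=> m ->; rewrite ltxx.
- by rewrite -[T]opprK; exact: supN.
Qed.

Lemma tops_sup S d v A T : tops d v A T -> supported S A -> supported S T.
Proof.
case=> hT T0 hR SA m mT; apply: SA; have e := hT _ mT.
have R0 : cf m (A - T) = 0.
  by apply: contrapT => /eqP/hR; rewrite e ltxx.
by move: R0; rewrite cfB => /subr0_eq ->.
Qed.

Lemma homM d v v' A B : homw d v A -> homw d v' B -> homw d (v + v') (A * B).
Proof. by apply: supM => m n <- <-; rewrite wtD. Qed.

Lemma hom_br d v v' A B :
  homw d v A -> homw d v' B -> homw d (v + v' - wxy d) (br A B).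
Proof.
apply: sup_br => m n k <- <- e; rewrite -wtD -e wtD /wxy; ring.
Qed.

Lemma topsM d v v' A B T U :
  tops d v A T -> tops d v' B U -> T * U != 0 -> tops d (v + v') (A * B) (T * U).
Proof.
move=> [hT _ hR] [hU _ hR'] TU; split=> //; first exact: homM.
have -> : A * B - T * U = (A - T) * (B - U) + (A - T) * U + T * (B - U) by ring.
apply: supD; first apply: supD.
- by apply: supM hR hR' => m n h1 h2; rewrite wtD; lia.
- by apply: supM hR hU => m n h1 h2; rewrite wtD; lia.
- by apply: supM hT hR' => m n h1 h2; rewrite wtD; lia.
Qed.

Lemma below_br d v v' A B T U : tops d v A T -> tops d v' B U ->
  below d (v + v' - wxy d) (br A B - br T U).
Proof.
move=> [hT _ hR] [hU _ hR'].
have -> : br A B - br T U = br (A - T) (B - U) + br (A - T) U + br T (B - U).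
  by rewrite !(brBl, brBr); ring.
have W m n k : k + (l%:Z, 1%N) = m + n -> wt d k = wt d m + wt d n - wxy d.
  by move=> e; rewrite -wtD -e wtD /wxy; ring.
apply: supD; first apply: supD.
- by apply: sup_br hR hR' => m n k h1 h2 /W ->; lia.
- by apply: sup_br hR hU => m n k h1 h2 /W ->; lia.
- by apply: sup_br hT hR' => m n k h1 h2 /W ->; lia.
Qed.

Lemma tops_br d v v' A B T U : tops d v A T -> tops d v' B U ->
  br T U != 0 -> tops d (v + v' - wxy d) (br A B) (br T U).
Proof.
move=> h h' TU; split=> //; last exact: below_br.
by case: h h' => hT _ _ [hU _ _]; exact: hom_br.
Qed.

Lemma tops_br0 d v v' A B T U : tops d v A T -> tops d v' B U ->
  br A B = 0 -> br T U = 0.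
Proof.
move=> h h' AB; apply: contrapT => /eqP TU.
by have /tops_neq0 := tops_br h h' TU; rewrite AB eqxx.
Qed.

Lemma single_mon A m : (forall n, cf n A != 0 -> n = m) ->
  A = mon (cf m A) m.
Proof.
move=> h; apply: cfP => n; rewrite cf_mon.
case: (eqVneq m n) => [->//|mn]; rewrite mulr0n.
by apply: contrapT => /eqP/h e; rewrite e eqxx in mn.
Qed.

Definition det2 (d d' : int * int) : int := d.1 * d'.2 - d.2 * d'.1.

Lemma wt_inj d d' m n : (0 < l)%N -> det2 d d' != 0 ->
  wt d m = wt d n -> wt d' m = wt d' n -> m = n.
Proof.
move=> l0 D; case: d d' m n D => [a b] [a' b'] [i j] [i' j'].
rewrite /det2 /wt /= => D e e'.
have e1 : (a * b' - b * a') * (i - i') = 0.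
  have -> : (a * b' - b * a') * (i - i') =
    b' * (a * i + b * (l%:Z * j%:Z) - (a * i' + b * (l%:Z * j'%:Z)))
    - b * (a' * i + b' * (l%:Z * j%:Z) - (a' * i' + b' * (l%:Z * j'%:Z))) by ring.
  by rewrite e e' !subrr !mulr0 subrr.
have e2 : (a * b' - b * a') * (l%:Z * (j%:Z - j'%:Z)) = 0.
  have -> : (a * b' - b * a') * (l%:Z * (j%:Z - j'%:Z)) =
    a * (a' * i + b' * (l%:Z * j%:Z) - (a' * i' + b' * (l%:Z * j'%:Z)))
    - a' * (a * i + b * (l%:Z * j%:Z) - (a * i' + b * (l%:Z * j'%:Z))) by ring.
  by rewrite e e' !subrr !mulr0 subrr.
move/eqP: e1; rewrite mulf_eq0 (negPf D) subr_eq0 => /eqP ->.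
move/eqP: e2; rewrite mulf_eq0 (negPf D) mulf_eq0 subr_eq0 /= => e2.
by congr pair; lia.
Qed.

(** Two independent weights separate exponents, so among the terms of equal [d]-weight a single one
    has maximal [d']-weight. *)
Lemma extreme d d' v A : (0 < l)%N -> det2 d d' != 0 -> homw d v A -> A != 0 ->
  exists m, [/\ cf m A != 0, wt d m = v & tops d' (wt d' m) A (mon (cf m A) m)].
Proof.
move=> l0 D hA A0; have [v' [T hT]] := tops_ex d' A0.
have hT1 : homw d v T := tops_sup hT hA.
have [hT2 /neq0_cf[m mT] hR] := hT.
have e := hT2 _ mT; have ev := hT1 _ mT.
have TE : T = mon (cf m T) m.
  by apply: single_mon => n nT; apply: (wt_inj l0 D); rewrite ?ev ?e ?hT1 ?hT2.
have cE : cf m A = cf m T.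
  apply: contrapT => /eqP; rewrite -subr_eq0 -cfB => /hR.
  by rewrite e ltxx.
by exists m; rewrite ev e cE -TE.
Qed.

(** Leading terms for the lexicographic order given by the weights [(1, 0)] and [(0, 1)] are
    monomials, and these multiply to a nonzero monomial. *)
Lemma mulm_neq0 A B : (0 < l)%N -> A != 0 -> B != 0 -> A * B != 0.
Proof.
move=> l0 A0 B0.
have [v [T hT]] := tops_ex (1, 0) A0; have [v' [U hU]] := tops_ex (1, 0) B0.
have D : det2 (1, 0) (0, 1) != 0 by [].
have [hT1 T0 _] := hT; have [hU1 U0 _] := hU.
have [m [mT _ tT]] := extreme l0 D hT1 T0.
have [n [nU _ tU]] := extreme l0 D hU1 U0.
apply/tops_neq0/(topsM hT hU).
apply/tops_neq0/(topsM tT tU).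
by rewrite monM mon_eq0 mulf_neq0.
Qed.

Lemma cross_wt d m n : d.1 * crossm m n = wt d m * n.2%:Z - wt d n * m.2%:Z.
Proof. by rewrite /crossm /wt; ring. Qed.

Lemma cross_wt' d m n :
  d.2 * l%:Z * crossm m n = m.1 * wt d n - n.1 * wt d m.
Proof. by rewrite /crossm /wt; ring. Qed.

(** The line through 0 and [k] is not a level line of the weight, so it meets each level line only
    once. *)
Lemma cross_eq0_inj d m n k : d != (0, 0) -> wt d k != 0 ->
  wt d m = wt d n -> crossm m k = 0 -> crossm n k = 0 -> m = n.
Proof.
move=> d0 k0 e hm hn.
have e2 : m.2%:Z = n.2%:Z.
  apply: (mulfI k0).
  have := cross_wt d m k; have := cross_wt d n k; rewrite hm hn e mulr0; lia.
have e1 : m.1 = n.1.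
  apply: (mulIf k0).
  have := cross_wt' d m k; have := cross_wt' d n k; rewrite hm hn e mulr0; lia.
by case: m n e1 e2 {hm hn e} => [? ?] [? ?] /= -> [->].
Qed.

End Tops.

(** * Elements commuting with a leading form *)

Section Commuting.
Context {K : fieldType} {l : nat} {M : model K l}.
Hypothesis charK : [pchar K] =i pred0.
Hypothesis l0 : (0 < l)%N.
Local Notation mon := (@mon K l M).
Local Notation cf := (@cf K l M).
Local Notation br := (@br K l M).
Local Notation wt := (@wt l).
Local Notation wxy := (@wxy l).
Implicit Types (A B C T U : M) (m n k : int * nat) (d : int * int) (v : int).

Lemma natK_eq0 (n : nat) : (n%:R == 0 :> K) = (n == 0%N).
Proof. by move/pcharf0P: charK => ->. Qed.

Lemma intK_eq0 (z : int) : (z%:~R == 0 :> K) = (z == 0).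
Proof.
case: z => n; first exact: natK_eq0.
by rewrite NegzE rmorphN oppr_eq0 /= natK_eq0.
Qed.

Lemma br_self A : br A A = 0.
Proof.
have /eqP := brAA A; rewrite scaler_eq0 natK_eq0 => /orP[//|/eqP//].
Qed.

Lemma br_mon_eq0 a b m n : a != 0 -> b != 0 ->
  (br (mon a m) (mon b n) == 0) = (crossm m n == 0).
Proof.
move=> a0 b0; rewrite br_mon mon_eq0 !mulf_eq0 (negPf a0) (negPf b0) /=.
by rewrite invr_eq0 natK_eq0 intK_eq0 eqn0Ngt l0 orbF.
Qed.

Lemma extreme_cross d v v' A B m n a b :
  a != 0 -> b != 0 -> tops d v A (mon a m) -> tops d v' B (mon b n) ->
  br A B = 0 -> crossm m n = 0.
Proof.
by move=> a0 b0 hA hB /(tops_br0 hA hB)/eqP; rewrite br_mon_eq0 // => /eqP.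
Qed.

(** The weight for [orth d] is [l] times the cross product with [d]: along a leading form it
    increases from the start point to the end point. *)
Definition orth d : int * int := (- d.2, d.1).

Lemma det2_orth d : d != (0, 0) -> det2 d (orth d) != 0.
Proof.
case: d => r s; rewrite /det2 /orth /= mulrN opprK => h.
rewrite paddr_eq0 ?sqr_ge0 -?expr2 ?sqr_ge0 // !sqrf_eq0.
by apply: contra h => /andP[/eqP-> /eqP->].
Qed.

(* The extreme exponent of an element commuting with [U] is determined by its
   weight, so a linear combination killing it must vanish. *)
Lemma commuting_prop d v u A B U : d != (0, 0) -> u != 0 ->
  homw d v A -> homw d v B -> B != 0 -> homw d u U -> U != 0 ->
  br A U = 0 -> br B U = 0 -> exists c, A = c *: B.
Proof.
move=> d0 u0 hA hB B0 hU U0 AU BU; have D := det2_orth d0.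
have [k [kU ku tU]] := extreme l0 D hU U0.
have ext C : homw d v C -> C != 0 -> br C U = 0 -> exists m,
    [/\ cf m C != 0, wt d m = v & crossm m k = 0].
  move=> hC C0 CU; have [m [mC mv tC]] := extreme l0 D hC C0.
  by exists m; split=> //; apply: extreme_cross mC kU tC tU CU.
have [m [mB mv mk]] := ext _ hB B0 BU.
exists (cf m A / cf m B); apply/eqP; rewrite -subr_eq0; apply: contrapT => /negP h.
have [||n [nC nv nk]] := ext _ _ h.
- by apply: supB => //; exact: supZ.
- by rewrite brBl brZl AU BU scaler0 subr0.
have e : n = m by apply: (@cross_eq0_inj l d n m k) => //; rewrite ?ku // nv.
by move: nC; rewrite e cfB cfZ divfK // subrr eqxx.
Qed.

End Commuting.

(** * Growth of K[P, Q] and leading forms that do not commute *)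

Section Growth.
Context {K : fieldType} {l : nat} {M : model K l}.
Hypothesis charK : [pchar K] =i pred0.
Hypothesis l0 : (0 < l)%N.
Local Notation mon := (@mon K l M).
Local Notation cf := (@cf K l M).
Local Notation br := (@br K l M).
Local Notation wt := (@wt l).
Local Notation wxy := (@wxy l).
Context (P Q : M) (c : K).
Hypothesis c0 : c != 0.
Hypothesis PQ : br P Q = c%:A.
Implicit Types (A B T U : M) (d : int * int) (v : int) (r : {poly K}).
Implicit Types (t : {poly {poly K}}).

Lemma br_alg A a : br A a%:A = 0.
Proof.
rewrite -(mon1 M) monZ; elim/(@model_ind K l M): A => [b m|A B e e'].
  by rewrite br_mon /crossm /= !mulr0 subrr mul0r mulr0 mon0.
by rewrite brDl e e' addr0.
Qed.

Lemma br_horner A B r :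
  br A (horner_alg B r) = horner_alg B r^`() * br A B.
Proof.
elim/poly_ind: r => [|r a IH]; first by rewrite deriv0 !rmorph0 br0r mul0r.
rewrite derivMXaddC !rmorphD !rmorphM /= horner_algX horner_algC.
by rewrite brDr br_alg brMr IH; ring.
Qed.

(** Bracketing a relation [r(P) = 0] with [Q] yields [r'(P) = 0], since [[Q, P]] is a nonzero
    constant; descent on the degree leaves only constant relations. *)
Lemma horner_alg_inj r : horner_alg P r = 0 -> r = 0.
Proof.
have [n] := ubnP (size r); elim: n r => // n IH r rn h.
have [->//|r0] := eqVneq r 0.
have r'0 : r^`() = 0.
  apply: IH; first by apply: leq_trans (lt_size_deriv r0) _; rewrite -ltnS.
  have : br Q (horner_alg P r) = 0 by rewrite h br0r.
  rewrite br_horner brC PQ -scaleNr mulr_algr => /eqP.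
  by rewrite scaler_eq0 oppr_eq0 (negPf c0) => /eqP.
have rE : r = (r`_0)%:P.
  apply/polyP => -[|i]; rewrite coefC //=.
  have := coef_deriv r i; rewrite r'0 coef0 => /esym/eqP.
  by rewrite -mulr_natr mulf_eq0 (natK_eq0 charK) orbF => /eqP.
move: h; rewrite rE horner_algC => /eqP.
by rewrite scaler_eq0 oner_eq0 orbF => /eqP ->.
Qed.

(** Elements of K[P, Q] are presented as polynomials in [Q] over K[P], because [[P, -]] then becomes
    [c] times the derivative in [Q] ([br_ev]). *)
Definition ev t : M := (map_poly (horner_alg P) t).[Q].

Lemma ev_is_additive : {morph ev : t u / t + u}.
Proof. by move=> t u; rewrite /ev rmorphD hornerD. Qed.

Lemma ev0 : ev 0 = 0.
Proof. by rewrite /ev rmorph0 horner0. Qed.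

Lemma ev_MXaddC t r : ev (t * 'X + r%:P) = ev t * Q + horner_alg P r.
Proof. by rewrite /ev rmorphD rmorphM /= map_polyX map_polyC hornerMXaddC. Qed.

Lemma br_ev t : br P (ev t) = c *: ev t^`().
Proof.
elim/poly_ind: t => [|t a IH]; first by rewrite deriv0 ev0 br0r scaler0.
rewrite ev_MXaddC derivMXaddC brDr brMr br_horner IH PQ br_self // mulr0 addr0.
have := ev_MXaddC t^`() 0; rewrite polyC0 addr0 rmorph0 addr0 => e.
by rewrite addrC ev_is_additive e scalerDr -scalerAl mulr_algr addrC.
Qed.

(** The same descent with the derivative in [Q]; its constant case is [horner_alg_inj]. Together
    they give the algebraic independence of [P] and [Q]. *)
Lemma ev_inj t : ev t = 0 -> t = 0.
Proof.
have [n] := ubnP (size t); elim: n t => // n IH t tn h.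
have [->//|t0] := eqVneq t 0.
have t'0 : t^`() = 0.
  apply: IH; first by apply: leq_trans (lt_size_deriv t0) _; rewrite -ltnS.
  have := br_ev t; rewrite h br0r => /esym/eqP.
  by rewrite scaler_eq0 (negPf c0) => /eqP.
have tE : t = (t`_0)%:P.
  apply/polyP => -[|i]; rewrite coefC //=; apply/polyP => j.
  have := coef_deriv t i; rewrite t'0 coef0 => /(congr1 (fun r => r`_j)).
  rewrite coef0 coefMn => /esym/eqP.
  by rewrite -mulr_natr mulf_eq0 (natK_eq0 charK) orbF => /eqP.
have := ev_MXaddC 0 t`_0; rewrite mul0r add0r -tE h ev0 mul0r add0r.
by move=> /esym/horner_alg_inj e; rewrite tE e.
Qed.

Lemma ev_sum n (u : 'I_n * 'I_n -> K) :
  ev (\sum_(q : 'I_n * 'I_n) (u q *: 'X^(q.1))%:P * 'X^(q.2)) =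
  \sum_(q : 'I_n * 'I_n) u q *: (P ^+ q.1 * Q ^+ q.2).
Proof.
have evS : forall (r : seq ('I_n * 'I_n)) f,
    ev (\sum_(q <- r) f q) = \sum_(q <- r) ev (f q).
  by move=> r f; rewrite (big_morph _ ev_is_additive ev0).
rewrite evS; apply: eq_bigr => q _.
rewrite /ev rmorphM /= map_polyC /= map_polyXn. rewrite hornerCM hornerXn.
by rewrite linearZ /= rmorphXn /= horner_algX mulr_algl -scalerAl.
Qed.

Lemma wt_bound d A : exists b : nat, supported (fun m => `|wt d m| <= b%:Z) A.
Proof.
elim/(@model_ind K l M): A => [a m|A B [a ha] [b hb]].
  by exists `|wt d m|%N; apply: sup_mon; lia.
exists (a + b)%N; apply: supD.
  by apply: supW ha => m; lia.
by apply: supW hb => m; lia.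
Qed.

Lemma wt_boundX d A (b i : nat) : supported (fun m => `|wt d m| <= b%:Z) A ->
  supported (fun m => `|wt d m| <= (b * i)%:Z) (A ^+ i).
Proof.
move=> h; elim: i => [|i IH].
  by rewrite expr0 -(mon1 M); apply: sup_mon; rewrite /wt /= !mulr0 addr0 muln0.
rewrite exprS; apply: supM h IH => m n hm hn; rewrite wtD; lia.
Qed.

Lemma tops_cf d v A T m : tops d v A T -> cf m T != 0 -> cf m A = cf m T.
Proof.
move=> [hT _ hR] mT; apply: contrapT => /eqP.
by rewrite -subr_eq0 -cfB => /hR; rewrite (hT _ mT) ltxx.
Qed.

(* Otherwise each weight would carry at most one leading form of an element of
   K[P, Q] up to a scalar, while the [n ^ 2] independent products
   [P ^+ i * Q ^+ j] only span weights in an interval linear in [n]. *)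
Lemma noncommuting_lead d u p : d != (0, 0) -> u != 0 -> tops d u P p ->
  exists t g v, tops d v (ev t) g /\ br g p != 0.
Proof.
move=> d0 u0 tP; apply: contrapT => noex.
have comm t g v : tops d v (ev t) g -> br g p = 0.
  by move=> h; apply: contrapT => /eqP h'; apply: noex; exists t, g, v.
(* Leading forms of the same weight are proportional here, so one exponent [f v] occurs in all of
   them. An element whose coefficient at [f v] is zero cannot have weight [v]. *)
have /choice[f hf] : forall v, exists m, forall t g,
    tops d v (ev t) g -> cf m g != 0.
  move=> v; have [[t [g h]]|no] := pselect (exists t g, tops d v (ev t) g).
    have [hg g0 _] := h; have [m mg] := neq0_cf g0.
    exists m => t' g' h'; have [hg' g0' _] := h'; have [hp p0 _] := tP.
    have [a e] := commuting_prop charK l0 d0 u0 hg' hg g0 hp p0 (comm _ _ _ h') (comm _ _ _ h).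
    rewrite e cfZ mulf_neq0 //; apply: contra_neq g0' => a0.
    by rewrite e a0 scale0r.
  by exists 0 => t g h; case: no; exists t, g.
have [b hbP] := wt_bound d P; have [b' hbQ] := wt_bound d Q.
(* The products have weights of absolute value at most [(b + b') * n], which leaves [D] values; this
   [n] makes [n ^ 2 = 2 (b + b') n + 2 n] exceed [D]. *)
pose n := (b + b').*2.+2.
pose D := ((b + b') * n).*2.+1.
have lt_D : (D < #|{: 'I_n * 'I_n}|)%N.
  rewrite card_prod !card_ord /D {2}/n mulSn mulSn -doubleMl; rewrite /n; lia.
pose e (q : 'I_n * 'I_n) := P ^+ q.1 * Q ^+ q.2.
pose X : 'M[K]_(#|{: 'I_n * 'I_n}|, D) :=
  \matrix_(i, s) cf (f (s%:Z - ((b + b') * n)%:Z)) (e (enum_val i)).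
(* A nonzero left kernel vector is a combination of the products whose coefficients at all the [f v]
   vanish. *)
have /rowV0Pn[w /sub_kermxP wX w0] : kermx X != 0.
  rewrite kermx_eq0 /row_free; apply/negP => /eqP rk.
  by have := rank_leq_col X; rewrite rk leqNgt lt_D.
pose z q := w 0 (enum_rank q).
pose t : {poly {poly K}} := \sum_q (z q *: 'X^(nat_of_ord q.1))%:P * 'X^(nat_of_ord q.2).
have tE : ev t = \sum_q z q *: e q by exact: ev_sum.
have t0 : ev t != 0.
  apply: contra w0 => /eqP/ev_inj t0; apply/eqP/rowP => i; rewrite mxE.
  rewrite -[i]enum_valK -/(z _); case: (enum_val i) => q1 q2.
  have := congr1 (fun r : {poly {poly K}} => r`_q2`_q1) t0.
  rewrite /t coef_sum coef_sum !coef0 => e0.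
  rewrite -[RHS]e0 (bigD1 (q1, q2)) //= big1 ?addr0 => [|[q1' q2'] ne].
    by rewrite coefCM coefXn eqxx mulr1 coefZ coefXn eqxx mulr1.
  rewrite coefCM coefXn /=; have [e2|e2] := eqVneq (q2 : nat) q2'; last first.
    by rewrite mulr0 coef0.
  rewrite mulr1 coefZ coefXn; have [e1|e1] := eqVneq (q1 : nat) q1'; last first.
    by rewrite mulr0.
  by case/eqP: ne; congr pair; apply: val_inj.
have [v [g tg]] := tops_ex d t0.
have vb : `|v| <= ((b + b') * n)%:Z.
  have [hg /neq0_cf[m mg] _] := tg; rewrite -(hg _ mg).
  have : supported (fun m => `|wt d m| <= ((b + b') * n)%:Z) (ev t).
    rewrite tE; elim/big_ind: _ => [|A B hA hB|q _].
    - exact: sup0.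
    - exact: supD.
    apply: supZ.
    apply: supM (wt_boundX (i := q.1) hbP) (wt_boundX (i := q.2) hbQ) => m1 m2 h1 h2.
     rewrite wtD; have := ltn_ord q.1; have := ltn_ord q.2; nia.
  by move/tops_sup: tg => h /h/(_ _ mg).
have sD : (`|(v + ((b + b') * n)%:Z)%R| < D)%N by rewrite /D; lia.
have := congr1 (fun Y : 'rV[K]_D => Y 0 (Ordinal sD)) wX; rewrite !mxE.
under eq_bigr do rewrite mxE /=.
have -> : `|(v + ((b + b') * n)%:Z)%R|%N%:Z - ((b + b') * n)%:Z = v by lia.
set m := f v => ewX; have mg := hf _ _ _ tg : cf m g != 0.
have := tops_cf tg mg; rewrite tE (big_morph (cf m) (@cfD _ _ M m) (cf0 _)).
rewrite (reindex_onto (@enum_val _ predT) enum_rank) => [|q _]; last exact: enum_rankK.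
rewrite (eq_bigl predT) => [|i]; last by rewrite enum_valK eqxx.
under eq_bigr do rewrite cfZ /z enum_valK.
by rewrite ewX => /eqP; rewrite eq_sym (negPf mg).
Qed.

(** [[-, P]] is [-c] times the derivative in [Q], so the degree in [Q] is a measure: whenever a
    later iterate has a noncommuting leading form, the search restarts from it. *)
Lemma last_noncommuting d u p : d != (0, 0) -> u != 0 -> tops d u P p ->
  exists t g v, [/\ tops d v (ev t) g, br g p != 0 & forall i g' v', (0 < i)%N ->
    tops d v' (iter i (fun A => br A P) (ev t)) g' -> br g' p = 0].
Proof.
move=> d0 u0 tP; have [t [g [v [tg gp]]]] := noncommuting_lead d0 u0 tP.
have [n] := ubnP (size t); elim: n t g v tg gp => // n IH t g v tg gp tn.
have step i : exists2 w, iter i (fun A => br A P) (ev t) = ev w &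
    (size w <= size t - i)%N.
  elim: i => [|i [w e sw]]; first by exists t; rewrite ?subn0.
  exists ((- c)%:P *: w^`()).
    rewrite iterS e brC br_ev /ev -mul_polyC rmorphM /= map_polyC /= hornerCM.
    by rewrite horner_algC mulr_algl scaleNr.
  apply: leq_trans (size_scale_leq _ _) _.
  have [->|/lt_size_deriv h] := eqVneq w 0; first by rewrite deriv0 size_poly0.
  by rewrite subnS -ltnS (leq_trans (leq_trans h sw)) // leqSpred.
have [[i [g' [v' [i0 tg' gp']]]]|no] := pselect (exists i g' v',
  [/\ (0 < i)%N, tops d v' (iter i (fun A => br A P) (ev t)) g' & br g' p != 0]).
  have [w e sw] := step i; rewrite e in tg'.
  (* The subtraction [size t - i] is truncated, so the strict decrease needs [w] to be nonzero,
     which its leading form guarantees. *)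
  apply: (IH w g' v') => //; have /tops_neq0 := tg'.
  have [-> /eqP//|w0 _] := eqVneq w 0; first by rewrite ev0.
  have : (0 < size w)%N by rewrite size_poly_gt0.
  lia.
exists t, g, v; split=> // i g' v' i0 tg'; apply: contrapT => /eqP gp'.
by apply: no; exists i, g', v'.
Qed.

End Growth.

(** * Divisibility in one variable *)

Section AdicValuation.
Context {K : fieldType}.
Hypothesis charK : [pchar K] =i pred0.
Implicit Types (q f g h k r A B : {poly K}).

(** The Euler operator: it multiplies ['X^i] by [i], and so records the position of a term on the
    line of exponents. *)
Definition theta f := 'X * f^`().

Lemma thetaD f g : theta (f + g) = theta f + theta g.
Proof. by rewrite /theta derivD mulrDr. Qed.

Lemma thetaM f g : theta (f * g) = theta f * g + f * theta g.
Proof. by rewrite /theta derivM; ring. Qed.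

(** The extra factor [q] avoids the exponent [a - 1]. *)
Lemma theta_exp q a : q * theta (q ^+ a) = a%:R * theta q * q ^+ a.
Proof. by rewrite /theta deriv_exp -mulr_natl; case: a => [|a]; rewrite ?mul0r ?mulr0 //= exprS; ring. Qed.

Lemma deriv_neq0 q : (1 < size q)%N -> q^`() != 0.
Proof.
move=> s; have q0 : q != 0 by rewrite -size_poly_gt0 (ltn_trans _ s).
apply/eqP => /(congr1 (fun r => r`_(size q).-2)); rewrite coef0 coef_deriv.
have -> : (size q).-2.+1 = (size q).-1 by lia.
move/eqP; rewrite -mulr_natr mulf_eq0 -[q`_(_)]/(lead_coef q) lead_coef_eq0 (negPf q0).
by rewrite (natK_eq0 charK) => /eqP; lia.
Qed.

Lemma irreducible_factor B : (1 < size B)%N ->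
  exists2 q, irreducible_poly q & q %| B.
Proof.
have [n] := ubnP (size B); elim: n B => // n IH B Bn B1.
have [[q [qB q1 qs]]|no] := pselect (exists q, [/\ q %| B, size q != 1%N & ~~ (q %= B)]).
  have B0 : B != 0 by rewrite -size_poly_gt0 (ltn_trans _ B1).
  have q0 : q != 0 by apply: contra_neq B0 => q0; move: qB; rewrite q0 dvd0p => /eqP.
  have lt : (size q < size B)%N.
    by rewrite ltn_neqAle dvdp_leq // andbT dvdp_size_eqp.
  have [||r ir rq] := IH q.
  - by apply: leq_trans lt _; rewrite -ltnS.
  - by rewrite ltn_neqAle eq_sym q1 size_poly_gt0.
  by exists r => //; exact: dvdp_trans rq qB.
exists B => //; split=> // q q1 qB; apply: contrapT => /negP qs.
by apply: no; exists q.
Qed.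

Lemma irreducible_dvdM q f g : irreducible_poly q ->
  (q %| f * g) = (q %| f) || (q %| g).
Proof.
move=> iq; have [qf|qf] := boolP (q %| f); first by rewrite dvdp_mulr.
by rewrite Gauss_dvdpr // irreducible_poly_coprime.
Qed.

Lemma adic_factor q f : irreducible_poly q -> f != 0 ->
  exists a f1, f = q ^+ a * f1 /\ ~~ (q %| f1).
Proof.
move=> iq; have [n] := ubnP (size f); elim: n f => // n IH f fn f0.
have [qf|qf] := boolP (q %| f); last by exists 0%N, f; rewrite mul1r.
have q1 : (1 < size q)%N by case: iq.
have q0 : q != 0 by rewrite -size_poly_gt0 (ltn_trans _ q1).
have fE := divpK qf.
have g0 : f %/ q != 0 by apply: contra_neq f0 => g0; rewrite -fE g0 mul0r.
have [||a [f1 [e qf1]]] := IH (f %/ q) => //.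
  have g1 : (0 < size (f %/ q)%R)%N by rewrite size_poly_gt0.
  have e : size f = (size (f %/ q)%R + size q).-1 by rewrite -{1}fE size_mul.
  move: fn q1; rewrite e; move: (size _) (size _) => x y; lia.
by exists a.+1, f1; rewrite exprS -mulrA -e mulrC fE.
Qed.

(** If an irreducible [q] divided [h / gcd], the hypothesis at one power above the multiplicity of
    [q] in the gcd would make [q] divide [A / gcd] too, against coprimality. *)
Lemma dvdp_of_adic h A : h != 0 -> A != 0 ->
  (forall q b, irreducible_poly q -> q ^+ b %| h -> q ^+ b %| A) -> h %| A.
Proof.
move=> h0 A0 val; set g := gcdp h A.
have g0 : g != 0 by rewrite gcdp_eq0 negb_and h0.
have hE : h %/ g * g = h by rewrite divpK ?dvdp_gcdl.
have AE : A %/ g * g = A by rewrite divpK ?dvdp_gcdr.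
have co : coprimep (h %/ g) (A %/ g) by apply: coprimep_div_gcd; rewrite h0.
have B0 : h %/ g != 0 by apply: contra_neq h0 => e; rewrite -hE e mul0r.
have [s|s] := leqP (size (h %/ g)) 1.
  have : h %/ g %| 1.
    rewrite dvdp1 eqn_leq s size_poly_gt0 //.
  by move=> /(dvdp_mul (dvdpp g)); rewrite mulr1 mulrC hE => /dvdp_trans; apply; exact: dvdp_gcdr.
have [q iq qB] := irreducible_factor s.
have q0 : q != 0 := irredp_neq0 iq.
have [e [g1 [gE qg1]]] := adic_factor iq g0.
have : q ^+ e.+1 %| h.
  by rewrite -hE {2}gE exprS dvdp_mul // dvdp_mulr.
move=> /(val _ _ iq); rewrite -AE {2}gE exprSr mulrCA dvdp_mul2l ?expf_neq0 //.
rewrite irreducible_dvdM // (negPf qg1) orbF => qA.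
have : q %| gcdp (h %/ g) (A %/ g) by rewrite dvdp_gcd qB.
move: co; rewrite /coprimep => /eqP co /dvdp_leq.
rewrite -size_poly_gt0 co => /(_ isT); case: iq => iq _.
by rewrite leqNgt iq.
Qed.

(** After multiplication by [q] and division by [q ^+ (a + c)], every term is a multiple of [q]
    except [(be a + al c) X q' f1 k1]. Since [q'] is nonzero of smaller degree than [q], no factor
    of this polynomial is divisible by [q], so the scalar vanishes. *)
Lemma adic_crit q a c f1 k1 al be e r : irreducible_poly q ->
  ~~ (q %| 'X) -> ~~ (q %| f1) -> ~~ (q %| k1) ->
  let f := q ^+ a * f1 in let k := q ^+ c * k1 in
  e *: (k * f) + be *: (k * theta f) + al *: (f * theta k) = r ->
  q ^+ (a + c) %| r -> be * a%:R + al * c%:R = 0 :> K.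
Proof.
move=> iq qX qf qk /= eq qr; apply: contrapT => /eqP ne.
have q0 : q != 0 := irredp_neq0 iq.
pose y := theta q * f1 * k1.
pose z := e *: (k1 * f1) + be *: (k1 * theta f1) + al *: (f1 * theta k1).
have E : q * r = q ^+ (a + c) * ((be * a%:R + al * c%:R) *: y + q * z).
  rewrite -eq !thetaM.
  rewrite /z /y -!mul_polyC polyCD !polyCM !polyC_natr exprD.
  have ea := theta_exp q a; have ec := theta_exp q c.
  transitivity (e%:P * q * (q ^+ c * k1 * (q ^+ a * f1)) +
    be%:P * (q ^+ c * k1) * ((q * theta (q ^+ a)) * f1 + q ^+ a * q * theta f1) +
    al%:P * (q ^+ a * f1) * ((q * theta (q ^+ c)) * k1 + q ^+ c * q * theta k1)).
    by ring.
  by rewrite ea ec; ring.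
have : q ^+ (a + c) * q %| q * r by rewrite mulrC dvdp_mul.
rewrite E dvdp_mul2l ?expf_neq0 // dvdp_addl ?dvdp_mulr // dvdpZr //.
rewrite /y /theta !irreducible_dvdM // (negPf qX) (negPf qf) (negPf qk) !orbF /=.
have q1 : (1 < size q)%N by case: iq.
move/dvdp_leq => /(_ (deriv_neq0 q1)); apply/negP; rewrite -ltnNge.
exact: lt_size_deriv.
Qed.

(* The two equations express [g, p] = h and [h, p] = 0 in the coordinate along
   the line of the exponents; comparing the leading [q]-adic coefficients
   gives [al * (a + c - b) = s * a] for the multiplicities [a], [b], [c] of [q]
   in [f], [h], [k], as soon as [a + c <= b]. *)
Lemma quotient_poly f k h u (e e' : K) (al be ga s : int) :
  f != 0 -> k != 0 -> h`_0 != 0 -> ga + s = al + be -> 0 < al * s ->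
  e *: (k * f) + be%:~R *: (k * theta f) - al%:~R *: (f * theta k) = u * h ->
  e' *: (h * f) + ga%:~R *: (h * theta f) - al%:~R *: (f * theta h) = 0 ->
  h %| k * f.
Proof.
move=> f0 k0 hh0 es als E1 E2.
have h0 : h != 0 by apply: contra_neq hh0 => ->; rewrite coef0.
apply: dvdp_of_adic => // [|q d iq qdh]; first by rewrite mulf_neq0.
have [b [h1 [hE qh1]]] := adic_factor iq h0.
have [a [f1 [fE qf1]]] := adic_factor iq f0.
have [c [k1 [kE qk1]]] := adic_factor iq k0.
have q0 : q != 0 := irredp_neq0 iq.
have q1 : (1 < size q)%N by case: iq.
have db : (d <= b)%N.
  rewrite leqNgt; apply/negP => bd; move: qdh.
  have -> : d = (b + (d - b).-1.+1)%N.
    by rewrite prednK ?subn_gt0 // subnKC // ltnW.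
  rewrite hE exprD dvdp_mul2l ?expf_neq0 // exprS => /(dvdp_trans (dvdp_mulr _ (dvdpp _))).
  by rewrite (negPf qh1).
apply: dvdp_trans (dvdp_exp2l _ db) _.
have qkf : q ^+ (a + c) %| k * f.
  by rewrite kE fE exprD mulrC dvdp_mul // dvdp_mulr.
have [bac|bac] := leqP b (a + c); first exact: dvdp_trans (dvdp_exp2l _ bac) qkf.
(* Here [b > a + c], so [q] divides [h], and the nonzero constant term of [h] excludes [X]. *)
have qX : ~~ (q %| 'X).
  apply/negP => qX; case/negP: hh0.
  have [b0|b0] := posnP b; first by rewrite b0 in bac.
  have e1 : q %= 'X.
    have iX : irreducible_poly ('X : {poly K}).
      by have := irredp_XsubC (0 : K); rewrite polyC0 subr0.
    by apply: (apply_irredp iX) => //; rewrite gtn_eqF.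
  have : 'X %| h by rewrite -(eqp_dvdl _ e1) hE -(prednK b0) exprS -mulrA dvdp_mulr.
  by rewrite -['X]subr0 -polyC0 dvdp_XsubCl => /rootP; rewrite horner_coef0 => ->.
have c1 : be%:~R * a%:R + - al%:~R * c%:R = 0 :> K.
  apply: (@adic_crit q a c f1 k1 (- al%:~R) be%:~R e (u * h)) => //.
    by rewrite -fE -kE scaleNr.
  by rewrite dvdp_mull // (dvdp_trans (dvdp_exp2l _ (ltnW bac))) // hE dvdp_mulr.
have c2 : ga%:~R * a%:R + - al%:~R * b%:R = 0 :> K.
  apply: (@adic_crit q a b f1 h1 (- al%:~R) ga%:~R e' 0) => //.
    by rewrite -fE -hE scaleNr.
have toZ (x y : int) (i j : nat) : x%:~R * i%:R + - y%:~R * j%:R = 0 :> K ->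
    x * i%:Z = y * j%:Z.
  move=> E; apply/eqP; rewrite -subr_eq0 -(intK_eq0 charK) rmorphB !rmorphM /=.
  by rewrite -mulNr E.
have {}c1 := toZ _ _ _ _ c1; have {}c2 := toZ _ _ _ _ c2.
have key : al * (a%:Z + c%:Z - b%:Z) = s * a%:Z.
  have -> : al * (a%:Z + c%:Z - b%:Z) = al * a%:Z + al * c%:Z - al * b%:Z by ring.
  by rewrite -c1 -c2 -[ga](addrK s) es; ring.
(* Only the sign of [al * s] is known, so [key] gets multiplied by [al]. *)
have al2 : 0 < al ^+ 2.
  by rewrite exprn_even_gt0 //=; apply: contraTneq als => ->; rewrite mul0r.
have : 0 <= a%:Z + c%:Z - b%:Z.
  rewrite -(pmulr_rge0 _ al2) expr2 -mulrA key mulrA.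
  by rewrite mulr_ge0 // ltW.
by rewrite subr_ge0 -PoszD lez_nat leqNgt bac.
Qed.

End AdicValuation.

(** * Homogeneous elements as polynomials in one variable *)

Section Line.
Context {K : fieldType} {l : nat} {M : model K l}.
Local Notation mon := (@mon K l M).
Local Notation cf := (@cf K l M).
Local Notation br := (@br K l M).
Local Notation wt := (@wt l).
Local Notation wxy := (@wxy l).
Implicit Types (A B : M) (m n k w : int * nat) (d : int * int) (v : int).
Implicit Types (f g r : {poly K}).

(** This is the monomial of exponent [m] times [f(z)], where [z] is the monomial of exponent [w]. *)
Definition psi w m f : M := \sum_(i < size f) mon f`_i (m + w *+ i).

Lemma psiw w m f N : (size f <= N)%N ->
  psi w m f = \sum_(i < N) mon f`_i (m + w *+ i).
Proof.
move=> fN; rewrite /psi (big_ord_widen N (fun i => mon f`_i (m + w *+ i)) fN).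
rewrite [RHS](bigID (fun i : 'I_N => (i < size f)%N)) /= [X in _ + X]big1 ?addr0 //.
by move=> i; rewrite -leqNgt => fi; rewrite nth_default // mon0.
Qed.

Lemma psiD w m f g : psi w m (f + g) = psi w m f + psi w m g.
Proof.
rewrite (psiw _ _ (leq_maxl (size f) (size g))) (psiw _ _ (leq_maxr (size f) (size g))).
rewrite (psiw _ _ (size_polyD f g)) -big_split; apply: eq_bigr => i _ /=.
by rewrite coefD monD.
Qed.

Lemma psi_monom w m a i : psi w m (a *: 'X^i) = mon a (m + w *+ i).
Proof.
have s : (size (a *: 'X^i : {poly K}) <= i.+1)%N.
  by rewrite (leq_trans (size_scale_leq _ _)) // size_polyXn.
rewrite (psiw _ _ s) big_ord_recr /= coefZ coefXn eqxx mulr1 big1 ?add0r //.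
by move=> j _; rewrite coefZ coefXn ltn_eqF ?mulr0 ?mon0.
Qed.

Lemma poly_sum_ind (S : {poly K} -> Prop) f : (forall a i, S (a *: 'X^i)) ->
  (forall g h, S g -> S h -> S (g + h)) -> S f.
Proof.
move=> S1 SD; rewrite -[f]coefK poly_def; elim/big_ind: _ => //.
by rewrite -(scale0r 'X^0).
Qed.

Lemma psiM w m n f g : psi w m f * psi w n g = psi w (m + n) (f * g).
Proof.
elim/poly_sum_ind: f => [a i|f f' e e']; last by rewrite mulrDl !psiD mulrDl e e'.
elim/poly_sum_ind: g => [b j|g g' e e']; last by rewrite mulrDr !psiD mulrDr e e'.
rewrite -scalerAl -scalerAr -exprD scalerA !psi_monom monM mulrnDr.
by rewrite addrACA.
Qed.

Lemma monM_psi w m n f : mon 1 n * psi w m f = psi w (n + m) f.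
Proof.
have := psi_monom w n 1 0; rewrite expr0 mulr0n addr0 => <-.
by rewrite psiM scale1r mul1r.
Qed.

Lemma psi_Xn w m f i : psi w (m + w *+ i) f = psi w m ('X^i * f).
Proof.
elim/poly_sum_ind: f => [a j|f f' e e']; last by rewrite mulrDr !psiD e e'.
by rewrite -scalerAr -exprD !psi_monom mulrnDr addrA.
Qed.

Lemma psiZ w m a f : psi w m (a *: f) = a *: psi w m f.
Proof.
elim/poly_sum_ind: f => [b j|f f' e e']; last by rewrite scalerDr !psiD e e' scalerDr.
by rewrite scalerA !psi_monom monZ.
Qed.

Lemma mulrn_pair w i : w *+ i = (w.1 * i%:Z, (w.2 * i)%N).
Proof.
elim: i => [|i IH]; first by rewrite muln0 mulr0.
by rewrite mulrS IH mulnS intS mulrDr mulr1.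
Qed.

Lemma add_mulrn_inj w m i j : w != 0 -> m + w *+ i = m + w *+ j -> i = j.
Proof.
rewrite !mulrn_pair; case: w m => [w1 w2] [m1 m2] w0 [e1 e2].
have {}e1 : w1 * (i%:Z - j%:Z) = 0 by move/addrI: e1; rewrite mulrBr => ->; rewrite subrr.
have {}e2 : (w2 * i = w2 * j)%N by move/addnI: e2.
have [z|z] := eqVneq w1 0; last by move/eqP: e1; rewrite mulf_eq0 (negPf z) /=; lia.
have [z'|z'] := posnP w2; first by rewrite z z' eqxx in w0.
by move/eqP: e2; rewrite eqn_mul2l gtn_eqF //= => /eqP.
Qed.

Lemma cf_psi w m f i : w != 0 -> cf (m + w *+ i) (psi w m f) = f`_i.
Proof.
move=> w0; elim/poly_sum_ind: f => [a j|f f' e e']; last by rewrite psiD cfD e e' coefD.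
rewrite psi_monom cf_mon coefZ coefXn; have [->|ij] := eqVneq i j.
  by rewrite eqxx mulr1.
by case: eqP => [/(add_mulrn_inj w0) e|_]; [rewrite e eqxx in ij | rewrite mulr0].
Qed.

Lemma psi_eq0 w m f : w != 0 -> psi w m f = 0 -> f = 0.
Proof. by move=> w0 e; apply/polyP => i; rewrite -(cf_psi m _ _ w0) e cf0 coef0. Qed.

Lemma psi_inj w m f g : w != 0 -> psi w m f = psi w m g -> f = g.
Proof.
by move=> w0 e; apply/polyP => i; rewrite -(cf_psi m _ _ w0) e cf_psi.
Qed.

Lemma sup_psi w m f : supported (fun k => exists i, k = m + w *+ i) (psi w m f).
Proof.
rewrite /psi; elim/big_ind: _ => [|A B hA hB|i _].
- exact: sup0.
- exact: supD.
- by apply: sup_mon; exists i.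
Qed.

Lemma psi_ex w m A : supported (fun k => exists i, k = m + w *+ i) A ->
  exists f, A = psi w m f.
Proof.
move=> h; apply: (sup_ind (Pr := fun A => exists f, A = psi w m f) h).
- by exists (0 *: 'X^0); rewrite psi_monom mon0.
- by move=> _ _ [f ->] [g ->]; exists (f + g); rewrite psiD.
- by move=> a _ [i ->]; exists (a *: 'X^i); rewrite psi_monom.
Qed.

(** The factor [xy] restores the shift of the bracket, so that exponents simply add and no
    predecessor remains. *)
Lemma xy_br_mon a m b n :
  mon 1 (l%:Z, 1%N) * br (mon a m) (mon b n) =
  mon (l%:R^-1 * (a * b * (crossm m n)%:~R)) (m + n).
Proof.
rewrite br_mon monM mul1r; have [mn|mn] := posnP (m.2 + n.2)%N.
  by rewrite (crossm0 mn) mul0r !mulr0 !mon0.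
rewrite mulrA mulrC; congr (mon _ _); congr pair => /=; first by rewrite addrC subrK.
by rewrite -[RHS](prednK mn).
Qed.

Lemma crossm_psi w m n i j : crossm (m + w *+ i) (n + w *+ j) =
  crossm m n + j%:Z * crossm m w - i%:Z * crossm n w.
Proof.
rewrite /crossm !mulrn_pair /= !PoszD !PoszM; ring.
Qed.

Lemma theta_monom a i : theta (a *: 'X^i : {poly K}) = (a * i%:R) *: 'X^i.
Proof.
rewrite /theta derivZ derivXn -scalerMnr -scaler_nat scalerA.
case: i => [|i]; first by rewrite mul0r mulr0 !scale0r mulr0.
by rewrite -scalerAr -exprS mulrC.
Qed.

(** The bracket in the coordinate [z]: by [crossm_psi] the cross product of two exponents is affine
    in their positions [i] and [j] on the lines, and [theta] turns these positions into
    operators. *)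
Definition line_br w m n f g : {poly K} := (crossm m n)%:~R *: (f * g)
  + (crossm m w)%:~R *: (f * theta g) - (crossm n w)%:~R *: (g * theta f).

Lemma line_br0 w m n f g :
  (line_br w m n f g)`_0 = (crossm m n)%:~R * (f`_0 * g`_0).
Proof.
rewrite /line_br /theta coefB coefD !coefZ !coef0M !coefX /=.
by rewrite !mul0r !mulr0 subr0 addr0.
Qed.

Lemma xy_br_psi w m n f g :
  mon 1 (l%:Z, 1%N) * br (psi w m f) (psi w n g) =
  psi w (m + n) (l%:R^-1 *: line_br w m n f g).
Proof.
rewrite /line_br psiZ.
elim/poly_sum_ind: f => [a i|f f' e e']; last first.
  rewrite psiD brDl mulrDr e e' -scalerDr -psiD thetaD.
  by congr (_ *: psi _ _ _); rewrite -!mul_polyC; ring.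
elim/poly_sum_ind: g => [b j|g g' e e']; last first.
  rewrite psiD brDr mulrDr e e' -scalerDr -psiD thetaD.
  by congr (_ *: psi _ _ _); rewrite -!mul_polyC; ring.
rewrite !theta_monom !psi_monom xy_br_mon -monZ; congr (_ *: _).
rewrite -!scalerAl -!scalerAr !scalerA -!exprD [(j + i)%N]addnC.
rewrite -scalerDl -scalerBl psi_monom mulrnDr addrACA; congr (mon _ _).
by rewrite crossm_psi rmorphB rmorphD !rmorphM /= ; ring.
Qed.

End Line.

(** * Division of homogeneous elements *)

Section Quotient.
Context {K : fieldType} {l : nat} {M : model K l}.
Hypothesis charK : [pchar K] =i pred0.
Hypothesis l0 : (0 < l)%N.
Local Notation mon := (@mon K l M).
Local Notation cf := (@cf K l M).
Local Notation br := (@br K l M).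
Local Notation wt := (@wt l).
Local Notation wxy := (@wxy l).
Implicit Types (A B p g : M) (m n k w : int * nat) (d : int * int) (v : int).
Implicit Types (f r : {poly K}).

(** [w] is a primitive exponent of weight zero. The third clause turns cross products with [w] into
    weights; the last one is primitivity, so that a single [w] generates all differences of
    exponents of equal weight. *)
Definition line_spec d w (e : int) := [/\ w != 0, e != 0,
  (forall m, e * crossm m w = wt d m) &
  (forall i j : int, d.1 * i + d.2 * (l%:Z * j) = 0 ->
     exists n : int, i = n * w.1 /\ j = n * w.2%:Z)].

Lemma line_ex d : d != (0, 0) -> exists w e, line_spec d w e.
Proof.
move=> d0; set a := d.1; set b := d.2 * l%:Z.
have g0 : gcdz a b != 0.
  rewrite gcdz_eq0; apply: contra d0 => /andP[/eqP a0]; rewrite mulf_eq0.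
  by case/orP => [/eqP b0|/eqP]; [rewrite [d]surjective_pairing -/a a0 b0 | lia].
set g := gcdz a b in g0 *.
pose r := (a %/ g)%Z; pose s := (b %/ g)%Z.
have aE : a = r * g by rewrite divzK // dvdz_gcdl.
have bE : b = s * g by rewrite divzK // dvdz_gcdr.
have [u [v uv]] := Bezoutz a b.
have {}uv : u * r + v * s = 1.
  by apply: (mulIf g0); rewrite mul1r -[RHS]uv mulrDl -!mulrA -aE -bE.
have ij i j : a * i + d.2 * (l%:Z * j) = 0 ->
    i = - s * (u * j - v * i) /\ j = r * (u * j - v * i).
  rewrite mulrA -/b aE bE => e.
  have {}e : r * i = - (s * j).
    by apply: (mulIf g0); apply/eqP; rewrite -subr_eq0 -e; apply/eqP; ring.
  split.
    transitivity (u * (r * i) + v * s * i); last by rewrite e; ring.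
    by rewrite mulrA -mulrDl uv mul1r.
  transitivity (u * r * j - v * (- (s * j))); last by rewrite -e; ring.
  by rewrite mulrN opprK mulrA -mulrDl uv mul1r.
have wtE m : wt d m = (m.1 * r + m.2%:Z * s) * g.
  by rewrite /wt mulrA -/a -/b aE bE; ring.
have rs : ~ (r = 0 /\ s = 0) by case=> r0 s0; rewrite r0 s0 !mulr0 in uv.
(* The generator is [(- s, r)] up to sign; the sign is chosen to make its y-exponent natural, and
   [e] absorbs it. *)
have [r0|r0] := leP 0 r.
  have rE : `|r|%N%:Z = r by rewrite gez0_abs.
  exists (- s, `|r|%N), g; split=> //= [|m|i j /ij[ei ej]].
  - by apply/eqP => -[/eqP]; rewrite oppr_eq0 => /eqP s0 /eqP; rewrite absz_eq0 => /eqP r00; case: rs.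
  - by rewrite /crossm /= rE wtE; ring.
  - by exists (u * j - v * i); rewrite rE; split; [rewrite {1}ei | rewrite {1}ej]; ring.
have rE : `|r|%N%:Z = - r by rewrite ltz0_abs.
exists (s, `|r|%N), (- g); split=> //= [||m|i j /ij[ei ej]].
- by apply/eqP => -[s0 /eqP]; rewrite absz_eq0 => /eqP r00; case: rs.
- by rewrite oppr_eq0.
- by rewrite /crossm /= rE wtE; ring.
- by exists (- (u * j - v * i)); rewrite rE; split; [rewrite {1}ei | rewrite {1}ej]; ring.
Qed.

Lemma line_wt d w e : line_spec d w e -> wt d w = 0.
Proof. by case=> _ e0 /(_ w) <- _; rewrite /crossm [w.1 * _]mulrC subrr mulr0. Qed.

Lemma wtMn d w i : wt d (w *+ i) = wt d w * i%:Z.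
Proof. by rewrite mulrn_pair /wt /= PoszM; ring. Qed.

Lemma line_diff d w e m k : line_spec d w e -> wt d m = wt d k ->
  (exists i, k = m + w *+ i) \/ (exists i, m = k + w *+ i).
Proof.
move=> [_ _ _ hw] emk.
have [|n [e1 e2]] := hw (k.1 - m.1) (k.2%:Z - m.2%:Z).
  move: emk; rewrite /wt => /eqP; rewrite eq_sym -subr_eq0 => /eqP <-; ring.
have [n0|n0] := leP 0 n; [left | right].
  exists `|n|%N; rewrite mulrn_pair; case: m k e1 e2 {emk} => [a b] [a' b'] /= e1 e2.
  congr pair => /=; first by rewrite gez0_abs // mulrC -e1; ring.
  by apply/eqP; rewrite -eqz_nat PoszD PoszM gez0_abs // mulrC -e2; lia.
exists `|n|%N; rewrite mulrn_pair; case: m k e1 e2 {emk} => [a b] [a' b'] /= e1 e2.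
congr pair => /=; first by rewrite ltz0_abs // mulrC mulNr -e1; ring.
by apply/eqP; rewrite -eqz_nat PoszD PoszM ltz0_abs // mulrC mulNr -e2; lia.
Qed.

Lemma hom_psi d v w e A : line_spec d w e -> homw d v A -> A != 0 ->
  exists m f, [/\ A = psi w m f, f`_0 != 0 & wt d m = v].
Proof.
move=> L hA A0; have [w0 e0 hw _] := L.
(* For this normal of [d] the exponent [w] has negative weight. The extreme exponent [m] is thus the
   origin of the ray in direction [w] that carries [A], and the constant coefficient is nonzero. *)
pose d' := (e * d.2, - (e * d.1)).
have e1 : e * w.2%:Z = d.1.
  by have := hw (1, 0%N); rewrite /crossm /wt /=; lia.
have e2 : e * w.1 = - (d.2 * l%:Z).
  by have := hw (0, 1%N); rewrite /crossm /wt /=; lia.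
have wl : l%:Z * wt d' w = - (e ^+ 2 * (w.1 ^+ 2 + (l%:Z * w.2%:Z) ^+ 2)).
  rewrite /wt /=; transitivity (e * (d.2 * l%:Z) * w.1 - e * l%:Z ^+ 2 * d.1 * w.2%:Z).
    by ring.
  have -> : d.2 * l%:Z = - (e * w.1) by rewrite e2 opprK.
  by rewrite -e1; ring.
have lZ : 0 < l%:Z by [].
have w_lt0 : wt d' w < 0.
  rewrite -(pmulr_rlt0 _ lZ) wl oppr_lt0 mulr_gt0 ?exprn_even_gt0 //=.
  rewrite lt_neqAle addr_ge0 ?sqr_ge0 // andbT eq_sym paddr_eq0 ?sqr_ge0 //.
  rewrite !sqrf_eq0 mulf_eq0 (gt_eqF lZ) /=; apply: contra w0 => /andP[/eqP w1 /eqP w2].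
  by case: (w) w1 w2 => [x y] /= -> [->].
have D : det2 d d' != 0.
  apply/eqP => D; have d1 : d.1 = 0 /\ d.2 = 0.
    have : e * (d.1 ^+ 2 + d.2 ^+ 2) = 0.
      by rewrite -[RHS]oppr0 -D /det2 /=; ring.
    move/eqP; rewrite mulf_eq0 (negPf e0) paddr_eq0 ?sqr_ge0 // !sqrf_eq0.
    by case/andP => /eqP -> /eqP ->.
  by move: w_lt0; rewrite /wt /= d1.1 d1.2; lia.
have [m [mA mv [_ _ hR]]] := extreme l0 D hA A0.
have line : supported (fun k => exists i, k = m + w *+ i) A.
  move=> k kA; have [->|km] := eqVneq k m; first by exists 0%N; rewrite mulr0n addr0.
  have := hR k; rewrite cfB cf_mon [m == k]eq_sym (negPf km) subr0 => /(_ kA) lt.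
  have [//|[i me]] := line_diff L (etrans mv (esym (hA _ kA))).
  by move: lt; rewrite me wtD wtMn; nia.
have [f fE] := psi_ex line.
exists m, f; split=> //; move: mA; rewrite fE.
by have := cf_psi m f 0 w0; rewrite mulr0n addr0 => ->.
Qed.

Lemma psi_hom d w e m f : line_spec d w e -> homw d (wt d m) (psi w m f : M).
Proof.
move=> L k /sup_psi[i ->].
by rewrite wtD wtMn (line_wt L) mul0r addr0.
Qed.

Lemma quotient d vp vg p g : d != (0, 0) -> 0 < wxy d -> 0 < vp ->
  homw d vp p -> p != 0 -> homw d vg g -> br g p != 0 -> br (br g p) p = 0 ->
  exists2 F : M, homw d (wxy d) F & br g p * F = g * p.
Proof.
move=> d0 s0 vp0 hp p0 hg h0 hp0; have [w [e L]] := line_ex d0.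
have [w0 e0 hw _] := L.
have g0 : g != 0 by apply: contra_neq h0 => ->; rewrite br0l.
have hh := hom_br hg hp.
have [mp [f [pE f0 mpv]]] := hom_psi L hp p0.
have [mg [k [gE k0 mgv]]] := hom_psi L hg g0.
have [mh [h [hE hh0 mhv]]] := hom_psi L hh h0.
have linv0 : (l%:R^-1 : K) != 0 by rewrite invr_eq0 (natK_eq0 charK) -lt0n.
have E2 : line_br w mh mp h f = 0.
  have := xy_br_psi (M := M) w mh mp h f; rewrite -hE -pE hp0 mulr0.
  move/esym/(psi_eq0 w0)/eqP; rewrite scaler_eq0 (negPf linv0) /=.
  by move/eqP.
have c_hp : crossm mh mp = 0.
  have := line_br0 w mh mp h f; rewrite E2 coef0 => /esym/eqP.
  by rewrite !mulf_eq0 (negPf hh0) (negPf f0) !orbF (intK_eq0 charK) => /eqP.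
pose X := l%:R^-1 *: line_br w mg mp k f.
have E1 : psi w ((l%:Z, 1%N) + mh) h = psi w (mg + mp) X :> M.
  by rewrite -xy_br_psi -gE -pE hE monM_psi.
(* [E1] writes one element from two base points of the same line. The nonzero constant term of [h]
   prevents its base point from lying strictly before [mg + mp]. *)
have [i [ei Xi]] : exists i, (l%:Z, 1%N) + mh = (mg + mp) + w *+ i /\ X = 'X^i * h.
  have [||[i ei]|[i ei]] := @line_diff d w e (mg + mp) ((l%:Z, 1%N) + mh) => //.
  - by rewrite !wtD mgv mpv mhv -/(wxy d); ring.
  - by exists i; split=> //; move: E1; rewrite ei psi_Xn => /(psi_inj w0).
  move: E1; rewrite ei psi_Xn => /(psi_inj w0) hX; case: i ei hX => [|i] ei hX.
    by exists 0%N; rewrite hX !mulr0n !addr0 expr0 !mul1r.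
  by move: hh0; rewrite hX coefXnM eqxx.
(* The y-exponent of [mF] must be natural. If [i = 0], then [mF] is the exponent of [xy]. Otherwise
   [X] has no constant term, so [mg] and [mh] are both parallel to [mp], and comparing weights gives
   [mh.2 <= mg.2 + mp.2]. *)
have [mF eF] : exists mF, mh + mF = mg + mp.
  case: i ei Xi => [|i] ei Xi.
    by exists (l%:Z, 1%N); rewrite addrC ei mulr0n addr0.
  have c_gp : crossm mg mp = 0.
    have : X`_0 = 0 by rewrite Xi coefXnM.
    move/eqP; rewrite /X coefZ line_br0 !mulf_eq0 (negPf linv0) (negPf k0) (negPf f0).
    by rewrite !orbF (intK_eq0 charK) => /eqP.
  have mh2 : (mh.2 <= mg.2 + mp.2)%N.
    have := @cross_wt l d mg mp; have := @cross_wt l d mh mp.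
    rewrite c_gp c_hp !mulr0 mgv mpv mhv => w1 w2.
    have e3 : vp * (mg.2%:Z + mp.2%:Z - mh.2%:Z) = wxy d * mp.2%:Z.
      apply/eqP; rewrite -subr_eq0; apply/eqP.
      transitivity (((vg + vp - wxy d) * mp.2%:Z - vp * mh.2%:Z) -
        (vg * mp.2%:Z - vp * mg.2%:Z)); first by ring.
      by rewrite -w1 -w2 subrr.
    rewrite -lez_nat PoszD -subr_ge0 -(pmulr_rge0 _ vp0) e3.
    by rewrite mulr_ge0 // ltW.
  exists (mg.1 + mp.1 - mh.1, (mg.2 + mp.2 - mh.2)%N); congr pair => /=.
    by rewrite addrC subrK.
  exact: subnKC.
have dv : h %| k * f.
  apply: (@quotient_poly _ charK f k h (l%:R *: 'X^i) (crossm mg mp)%:~R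
    (crossm mh mp)%:~R (crossm mp w) (crossm mg w) (crossm mh w)
    (crossm (l%:Z, 1%N) w)) => //.
  - by apply: contra_neq f0 => ->; rewrite coef0.
  - by apply: contra_neq k0 => ->; rewrite coef0.
  - by apply: (mulfI e0); rewrite [LHS]mulrDr [RHS]mulrDr !hw mgv mpv mhv -/(wxy d); ring.
  - have : 0 < (e * crossm mp w) * (e * crossm (l%:Z, 1%N) w).
      by rewrite !hw mpv mulr_gt0.
    by rewrite mulrACA -expr2 pmulr_rgt0 // exprn_even_gt0.
  - rewrite -/(line_br w mg mp k f) -scalerAl -Xi /X scalerA divff ?scale1r //.
    by rewrite -invr_eq0.
have [r rE] := dvdpP _ _ dv.
exists (psi w mF r).
  have <- : wt d mF = wxy d; last exact: psi_hom L.
  by apply: (addrI (wt d mh)); rewrite -wtD eF wtD mhv mgv mpv; ring.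
by rewrite hE gE pE !psiM eF rE mulrC.
Qed.

End Quotient.

(** * The homogeneous element F *)

Section LeadingForms.
Context {K : fieldType} {l : nat} {M : model K l}.
Hypothesis charK : [pchar K] =i pred0.
Hypothesis l0 : (0 < l)%N.
Local Notation mon := (@mon K l M).
Local Notation cf := (@cf K l M).
Local Notation br := (@br K l M).
Local Notation wt := (@wt l).
Local Notation wxy := (@wxy l).
Implicit Types (A B p g F : M) (m n k u : int * nat) (d : int * int) (v : int).

(** Induction over K[P, Q], used both for [in_gen_alg] and for supports in a sublattice. *)
Lemma ev_in (P Q : M) (S : M -> Prop) t : (forall a, S a%:A) ->
  (forall A B, S A -> S B -> S (A + B)) -> (forall A B, S A -> S B -> S (A * B)) ->
  S P -> S Q -> S (ev P Q t).
Proof.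
move=> S1 SD SM SP SQ; have S0 : S 0 by have := S1 0; rewrite scale0r.
have Sr r : S (horner_alg P r).
  elim/poly_ind: r => [|r a IH]; first by rewrite rmorph0.
  by rewrite rmorphD rmorphM /= horner_algX horner_algC; apply: (SD) => //; apply: SM.
elim/poly_ind: t => [|t a IH]; first by rewrite ev0.
by rewrite ev_MXaddC; apply: (SD) => //; apply: SM.
Qed.

Lemma wxyE d : wxy d = l%:Z * (d.1 + d.2).
Proof. by rewrite /wxy /wt /= mulr1; ring. Qed.

Lemma dir_neq0 d : 0 < d.1 + d.2 -> d != (0, 0).
Proof. by apply: contraTneq => ->. Qed.

Lemma leading_F (P Q : M) (c : K) d vp p : 0 < d.1 + d.2 -> 0 < vp ->
  tops d vp P p -> c != 0 -> br P Q = c%:A ->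
  exists t g v F, [/\ tops d v (ev P Q t) g,
    [/\ homw d (wxy d) F, F != 0, br F p = p & br g p * F = g * p] &
    forall i g' v', (0 < i)%N ->
      tops d v' (iter i (fun A => br A P) (ev P Q t)) g' -> br g' p = 0].
Proof.
move=> d0 vp0 tP c0 PQ; have dn := dir_neq0 d0.
have s0 : 0 < wxy d by rewrite wxyE mulr_gt0.
have [|t [g [v [tg gp Gi]]]] := last_noncommuting charK l0 c0 PQ dn _ tP.
  by rewrite gt_eqF.
have hp : br (br g p) p = 0.
  by apply: (Gi 1%N _ _ isT (tops_br tg tP gp)).
have [hP p0 _] := tP; have [hg g0 _] := tg.
have [F hF FE] := quotient charK l0 dn s0 vp0 hP p0 hg gp hp.
have F0 : F != 0.
  by apply: contra_neq (mulm_neq0 l0 g0 p0) => F0; rewrite -FE F0 mulr0.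
exists t, g, v, F; split=> //; split=> //.
apply/eqP; rewrite -subr_eq0; apply: contrapT => /negP ne.
have /eqP := mulm_neq0 l0 gp ne; apply.
have := congr1 (fun A => br A p) FE; rewrite !brMl hp (br_self charK).
by rewrite mul0r addr0 mulr0 add0r mulrBr => ->; rewrite subrr.
Qed.

Lemma crossmC m n : crossm m n = - crossm n m.
Proof. by rewrite /crossm; ring. Qed.

(** The extreme terms of [F] and [p] either commute, or their bracket is the extreme term of [[F, p]
    = p]; in the latter case comparing exponents forces [u] to be that of [xy]. *)
Lemma extreme_F d d' vp F p u m a b : d != (0, 0) -> vp != 0 -> wt d m = vp ->
  wt d u = wxy d -> a != 0 -> b != 0 ->
  tops d' (wt d' u) F (mon a u) -> tops d' (wt d' m) p (mon b m) ->
  br F p = p ->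
  (crossm u m = 0 \/ u = (l%:Z, 1%N)) /\ crossm m (l%:Z, 1%N) != 0.
Proof.
move=> dn vp0 mv uv a0 b0 tF tp Fp.
have [um|um] := eqVneq (crossm u m) 0.
  split; first by left.
  (* If [m] were parallel to the exponent of [xy], then [u], of the same weight as [xy], would equal
     it. As the extreme terms commute, [[F, p]] would have no term at [m], but [p] has one. *)
  apply: contraTneq isT => m1; have ue : u = (l%:Z, 1%N).
    apply: (@cross_eq0_inj l d u (l%:Z, 1%N) m) => //; first by rewrite mv.
    by rewrite crossmC m1 oppr0.
  have z : br (mon a u) (mon b m) = 0.
    by apply/eqP; rewrite br_mon_eq0 // um.
  have := below_br tF tp; rewrite Fp z subr0 => /(_ m).
  rewrite (tops_cf tp) ?cf_mon ?eqxx //= => /(_ b0).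
  by rewrite ue /wxy; lia.
have nz : br (mon a u) (mon b m) != 0 by rewrite br_mon_eq0.
have := tops_br tF tp nz; rewrite Fp => /tops_uniq/(_ tp)[_].
rewrite br_mon => e; have um2 : (0 < u.2 + m.2)%N.
  by rewrite lt0n; apply: contra um => /eqP/crossm0 ->.
have := congr1 (cf m) e; rewrite !cf_mon eqxx mulr1n.
case: eqP => [em _|_ /esym/eqP]; last by rewrite mulr0n (negPf b0).
have ue : u = (l%:Z, 1%N).
  case: (u) (m) em um2 => [x y] [x' y'] /= [e1 e2] y0.
  by congr pair; lia.
by split; [right | rewrite crossmC -ue oppr_eq0].
Qed.

(** The direction [(-1, 0)] selects the smallest x-exponent of [F]: that of [xy], or a positive
    multiple of the one in [p]. It is independent of [d] unless [d.2 = 0], and then all terms of [F]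
    have the x-exponent of [xy]. *)
Lemma supported_nonneg d vp F p : 0 < d.1 + d.2 -> 0 < vp -> homw d vp p ->
  p != 0 -> homw d (wxy d) F -> F != 0 -> br F p = p ->
  supported (fun m => 0 <= m.1) p -> supported (fun m => 0 <= m.1) F.
Proof.
move=> d0 vp0 hp p0 hF F0 Fp Sp k kF; have dn := dir_neq0 d0.
have s0 : 0 < wxy d by rewrite wxyE mulr_gt0.
have [d2|d2] := eqVneq d.2 0.
  have := hF _ kF; move: s0; rewrite /wxy /wt d2 !mul0r !addr0 /= => s0 e.
  by nia.
have D : det2 d (-1, 0) != 0 by rewrite /det2 /= mulr0 mulrN1 opprK add0r.
have [m [mp mv tp]] := extreme l0 D hp p0.
have [u [uF uv tF]] := extreme l0 D hF F0.
have u1 : 0 <= u.1.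
  have [[um|-> //] _] := extreme_F dn (lt0r_neq0 vp0) mv uv uF mp tF tp Fp.
  have := @cross_wt' l d u m; rewrite um mulr0 mv uv => /esym/subr0_eq e.
  by rewrite -(pmulr_lge0 _ vp0) e mulr_ge0 ?Sp // ltW.
have [->//|ku] := eqVneq k u.
have [_ _ hR] := tF; have := hR k; rewrite cfB cf_mon eq_sym [u == k]eq_sym.
rewrite (negPf ku) subr0 eq_sym => /(_ kF).
by rewrite /wt /=; lia.
Qed.

(* The quotient of elements with exponents in a sublattice has its exponents in
   that sublattice: the part of [F] off the sublattice is annihilated by [h]. *)
Lemma supported_quotient (S : pred (int * nat)) (h F r : M) :
  (forall m n, S m -> S n = S (m + n)) -> h != 0 -> h * F = r ->
  supported S h -> supported S r -> supported S F.
Proof.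
move=> SD h0 e Sh Sr; have [T [R [FE hT hR]]] := sup_split S F.
suff R0 : R = 0 by rewrite FE R0 addr0.
apply: contrapT => /eqP/(mulm_neq0 l0 h0)/eqP; apply.
apply: (@sup_contra _ _ _ (fun m => ~~ S m) S).
- by move=> m /negP.
- by apply: supM Sh hR => m n Sm; rewrite (SD m n).
have -> : h * R = r - h * T by rewrite -e FE; ring.
by apply: supB => //; apply: supM Sh hT => m n Sm; rewrite (SD m n).
Qed.

End LeadingForms.

(** * The ring laurent K l *)

Section Instance.
Context {K : fieldType} {l : nat}.
Local Notation L := (laurent K l).
Local Notation mono := (@Defs.mono K l).
Implicit Types (A B C : L) (m n : int * nat) (S : {fset (int * nat)}).

Lemma dxw S A : (msupp A `<=` S)%fset ->
  dx A = \sum_(m <- S) mono (mcoeff m A * (m.1%:~R / l%:R)) (m.1 - l%:Z, m.2).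
Proof.
move=> le; rewrite /dx; apply: (big_fset_incl _ le) => m _ /mcoeff_outdom ->.
by rewrite mul0r Defs.mono0.
Qed.

Lemma dyw S A : (msupp A `<=` S)%fset ->
  dy A = \sum_(m <- S) mono (mcoeff m A * m.2%:R) (m.1, m.2.-1).
Proof.
move=> le; rewrite /dy; apply: (big_fset_incl _ le) => m _ /mcoeff_outdom ->.
by rewrite mul0r Defs.mono0.
Qed.

Lemma dxD A B : dx (A + B) = dx A + dx B.
Proof.
rewrite (dxw (fsubsetUl (msupp A) (msupp B))).
rewrite (dxw (fsubsetUr (msupp A) (msupp B))) (dxw (msuppD_le A B)).
by rewrite -big_split; apply: eq_bigr => m _; rewrite mcoeffD mulrDl Defs.monoD.
Qed.

Lemma dyD A B : dy (A + B) = dy A + dy B.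
Proof.
rewrite (dyw (fsubsetUl (msupp A) (msupp B))).
rewrite (dyw (fsubsetUr (msupp A) (msupp B))) (dyw (msuppD_le A B)).
by rewrite -big_split; apply: eq_bigr => m _; rewrite mcoeffD mulrDl Defs.monoD.
Qed.

Lemma dx_mono a m :
  dx (mono a m) = mono (a * (m.1%:~R / l%:R)) (m.1 - l%:Z, m.2).
Proof. by rewrite (dxw msuppU_le) big_seq_fset1 mcoeffUU. Qed.

Lemma dy_mono a m : dy (mono a m) = mono (a * m.2%:R) (m.1, m.2.-1).
Proof. by rewrite (dyw msuppU_le) big_seq_fset1 mcoeffUU. Qed.

Lemma bracketDl A B C : bracket (A + B) C = bracket A C + bracket B C.
Proof.
rewrite /bracket dxD dyD.
suff gen (R : pzRingType) (a b c d e f : R) :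
    (a + b) * e - (c + d) * f = (a * e - c * f) + (b * e - d * f) by exact: gen.
by rewrite !mulrDl opprD addrACA.
Qed.

Lemma bracketDr A B C : bracket A (B + C) = bracket A B + bracket A C.
Proof.
rewrite /bracket dxD dyD.
suff gen (R : pzRingType) (a b c d e f : R) :
    e * (a + b) - f * (c + d) = (e * a - f * c) + (e * b - f * d) by exact: gen.
by rewrite !mulrDr opprD addrACA.
Qed.

Lemma monoB m (a b : K) : mono a m - mono b m = mono (a - b) m.
Proof. by have := @Defs.monoD K l m (a - b) b; rewrite subrK => ->; exact: addrK. Qed.

Lemma bracket_mono (a : K) m (b : K) n : bracket (mono a m) (mono b n) =
  mono (a * b * ((crossm m n)%:~R / l%:R)) (m.1 + n.1 - l%:Z, (m.2 + n.2)%N.-1).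
Proof.
rewrite /bracket !dx_mono !dy_mono !Defs.monoM.
set q := (m.1 + n.1 - l%:Z, (m.2 + n.2)%N.-1).
have -> : mono (a * (m.1%:~R / l%:R) * (b * n.2%:R))
    ((m.1 - l%:Z, m.2) + (n.1, n.2.-1)) =
  mono (a * (m.1%:~R / l%:R) * (b * n.2%:R)) q.
  have [-> | n2] := posnP n.2; first by rewrite !mulr0 !Defs.mono0.
  congr (mono _ _); congr pair => /=; first by ring.
  by rewrite /q -[in RHS](prednK n2) addnS.
have -> : mono (a * m.2%:R * (b * (n.1%:~R / l%:R)))
    ((m.1, m.2.-1) + (n.1 - l%:Z, n.2)) =
  mono (a * m.2%:R * (b * (n.1%:~R / l%:R))) q.
  have [-> | m2] := posnP m.2; first by rewrite mulr0 !mul0r !Defs.mono0.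
  congr (mono _ _); congr pair => /=; first by ring.
  by rewrite /q -[in RHS](prednK m2) addSn.
have -> : a * b * ((crossm m n)%:~R / l%:R) =
    a * (m.1%:~R / l%:R) * (b * n.2%:R) - a * m.2%:R * (b * (n.1%:~R / l%:R)).
  by rewrite /crossm rmorphB !rmorphM /=; ring.
exact: monoB.
Qed.

Lemma mcoeff_mono (a : K) m n : mcoeff n (mono a m) = a *+ (m == n).
Proof. exact: mcoeffU. Qed.

Definition laurent_model : model K l :=
  @Model K l (laurent K l : comAlgType K) (fun m A => mcoeff m A) mono
    (fun A => msupp A) (@bracket K l) (fun m A B => mcoeffD m A B)
    (fun m c A => mcoeffZ c A m) (@laurentP K l) mcoeff_mono
    (@laurentE K l) (@Defs.monoM K l) erefl bracketDl bracketDr bracket_mono.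

Local Notation wt := (@wt l).

Lemma vpt_wt d m : (0 < l)%N -> vpt d (expo l m) = (wt d m)%:~R / l%:R.
Proof.
move=> l0; rewrite /vpt /expo /wt /= rmorphD !rmorphM /= -!pmulrn.
by field; rewrite pnatr_eq0 -lt0n.
Qed.

Local Notation M := laurent_model.
Implicit Types (T : L) (d : int * int) (v : int).

Lemma mem_Supp A m : mcoeff m A != 0 -> expo l m \in Supp A.
Proof. by rewrite mcoeff_neq0 => mA; apply/imfsetP; exists m. Qed.

Lemma tops_lead d v A T : (0 < l)%N -> tops (M := M) d v A T ->
  lead d A = T /\ vdeg d A = (v%:~R / l%:R : rat)%:E.
Proof.
move=> l0 tA; have [hT /neq0_cf[m mT] hR] := tA.
have l0' : 0 < (l%:R : rat) by rewrite ltr0n.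
have vm : vpt d (expo l m) = v%:~R / l%:R by rewrite vpt_wt // (hT m mT).
have mA : mcoeff m A != 0.
  by have := tops_cf tA mT; rewrite /cf /= => ->.
have low n : mcoeff n A != 0 -> wt d n <= v.
  move=> nA; have [z|nT] := eqVneq (cf n (T : M)) 0; last by rewrite (hT n nT).
  apply/ltW/(hR n); rewrite cfB z subr0; exact: nA.
have vE : vdeg d A = (v%:~R / l%:R : rat)%:E.
  apply/le_anti/andP; split; last first.
    by rewrite -vm; apply: vdeg_le; exact: mem_Supp.
  rewrite /vdeg big_seq; elim/big_ind: _ => [|x y hx hy|p].
  - exact: leNye.
  - by rewrite ge_max hx.
  case/imfsetP => n /=; rewrite -mcoeff_neq0 => nA ->.
  by rewrite lee_fin vpt_wt // ler_pM2r ?invr_gt0 // ler_int; exact: low.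
split=> //; apply: laurentP => n; rewrite lead_coeff vE vpt_wt //.
have inj : ((wt d n)%:~R / l%:R == v%:~R / l%:R :> rat) = (wt d n == v).
  by rewrite (inj_eq (mulIf _)) ?eqr_int // invr_eq0 gt_eqF.
have -> : (((wt d n)%:~R / l%:R : rat)%:E == (v%:~R / l%:R : rat)%:E) = (wt d n == v).
  by rewrite -inj; apply/eqP/eqP => [[->]|->].
have [e|ne] := eqVneq (wt d n) v.
  have : cf n (A - T : M) = 0.
    by apply: contrapT => /eqP/(hR n); rewrite e ltxx.
  by rewrite cfB => /subr0_eq.
have [z|nT] := eqVneq (cf n (T : M)) 0; first exact: esym z.
by rewrite (hT n nT) eqxx in ne.
Qed.

Lemma lead0 d : lead d (0 : L) = 0.
Proof.
by apply: laurentP => m; rewrite lead_coeff mcoeff0 if_same.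
Qed.

(** A point of a segment has its cross product with [d] between those of the endpoints, so the
    endpoints are the extremes of this cross product, which determines a point of a leading form. *)
Lemma st_en_extreme d A m n a b : (0 < l)%N -> d != (0, 0) -> A != 0 ->
  a != 0 -> b != 0 ->
  tops (M := M) (d.2, - d.1) (wt (d.2, - d.1) m) (lead d A) (mono a m) ->
  tops (M := M) (orth d) (wt (orth d) n) (lead d A) (mono b n) ->
  st d A = expo l m /\ en d A = expo l n.
Proof.
move=> l0 d0 A0 a0 b0 tm tn.
have l0' : 0 < (l%:R : rat) by rewrite ltr0n.
have crossE (k : int * nat) : cross (ratdir d) (expo l k) =
    (wt (orth d) k)%:~R / l%:R.
  rewrite /cross /wt /= rmorphD !rmorphM rmorphN /= -!pmulrn.
  by field; rewrite pnatr_eq0 -lt0n.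
have wtN k : wt (d.2, - d.1) k = - wt (orth d) k by rewrite /wt /=; ring.
have bound d' k u c : c != 0 -> tops (M := M) d' (wt d' u) (lead d A) (mono c u) ->
    mcoeff k (lead d A) != 0 -> wt d' k <= wt d' u.
  move=> c0 [_ _ hR] kA; have [->//|ku] := eqVneq k u.
  apply/ltW/hR; rewrite cfB; have -> : cf k (mono c u : M) = 0.
    by have := cf_mon M c u k; rewrite [u == k]eq_sym (negPf ku).
  by rewrite subr0; exact: kA.
have inS d' u c : c != 0 -> tops (M := M) d' (wt d' u) (lead d A) (mono c u) ->
    mcoeff u (lead d A) != 0.
  move=> c0 tu; have e := cf_mon M c u u; rewrite eqxx in e.
  have cu : cf u (mono c u : M) != 0 by rewrite e.
  by have := tops_cf tu cu; rewrite e => e'; rewrite -[mcoeff _ _]/(cf u (lead d A : M)) e'.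
have {}crossE k : (mcoeff k (lead d A) != 0) ->
    cross (ratdir d) (expo l m) <= cross (ratdir d) (expo l k) <= cross (ratdir d) (expo l n).
  move=> kA; rewrite !crossE !ler_pM2r ?invr_gt0 // !ler_int (bound _ _ _ _ b0 tn kA).
  by have := bound _ _ _ _ a0 tm kA; rewrite !wtN lerN2 => ->.
have mS := mem_Supp (inS _ _ _ a0 tm); have nS := mem_Supp (inS _ _ _ b0 tn).
have same p q : p \in Supp (lead d A) -> q \in Supp (lead d A) -> vpt d p = vpt d q.
  by move=> /Supp_leadP hp /Supp_leadP hq; apply: EFin_inj; rewrite hp hq.
have bnd p : p \in Supp (lead d A) ->
    cross (ratdir d) (expo l m) <= cross (ratdir d) p <= cross (ratdir d) (expo l n).
  by case/imfsetP => k /=; rewrite -mcoeff_neq0 => kA ->; exact: crossE.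
have := st_enP d0 A0; rewrite /endpoints /=; case: ifP => _.
  case=> SE; rewrite SE in mS nS; move: mS nS; rewrite !in_fset1 => /eqP <- /eqP -> ->.
  by [].
case=> sS eS seg; set s := st d A in sS eS seg *; set e := en d A in sS eS seg *.
rewrite /cross /= => se.
have segb p : segment s e p -> cross (ratdir d) s <= cross (ratdir d) p <= cross (ratdir d) e.
  case=> t /andP[t0 t1] ->; rewrite /cross /=; apply/andP; split; nra.
have /andP[s1 _] := segb _ (seg _ mS); have /andP[_ e1] := segb _ (seg _ nS).
have /andP[s2 _] := bnd _ sS; have /andP[_ e2] := bnd _ eS.
split; apply: (vpt_cross_inj d0); try exact: same.
  by apply/le_anti/andP.
by apply/le_anti/andP.
Qed.

Lemma in_Kxy_supported A : (0 < l)%N -> in_Kxy A <->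
  supported (M := M) (fun m => 0 <= m.1 /\ (l%:Z %| m.1)%Z) A.
Proof.
move=> l0; have l0' : (l%:R : rat) != 0 by rewrite pnatr_eq0 -lt0n.
split=> [h m mA|h p].
  have := h _ (mem_Supp mA); rewrite /expo /= => /natrP[k e].
  have -> : m.1 = (k * l)%N%:Z.
    apply: (@intr_inj rat); rewrite -[LHS](divfK l0') e -pmulrn natrM; ring.
  by split=> //; rewrite PoszM dvdz_mull.
case/imfsetP => m /=; rewrite -mcoeff_neq0 => /(h m)[m0 /dvdzP[q e]] -> /=.
have q0 : 0 <= q by move: m0; rewrite e pmulr_lge0.
by rewrite e rmorphM /= -pmulrn mulfK // -[q]gez0_abs // natr_nat.
Qed.

End Instance.

Lemma vdeg0 (K : fieldType) (l : nat) d : vdeg d (0 : laurent K l) = -oo%E.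
Proof.
rewrite /vdeg big_seq; elim/big_ind: _ => [//|x y -> ->|p]; first by rewrite maxxx.
by case/imfsetP => m /=; rewrite -mcoeff_neq0 mcoeff0 eqxx.
Qed.

Theorem theorem2p6 (K : fieldType) (charK : [pchar K] =i pred0)
    (l : nat) (l_gt0 : (0 < l)%N) (P : laurent K l)
    (rho sigma : int) (rs_pos : dirpos (rho, sigma))
    (vP_gt0 : (0 < vdeg (rho, sigma) P)%E)
    (Q : laurent K l)
    (PQ_unit : exists2 c : K, c != 0 & bracket P Q = c%:A) :
  let d := (rho, sigma) in
  exists (G0 F : laurent K l),
    (in_gen_alg P Q G0 /\ G0 != 0) /\
    homogeneous d F /\
    vdeg d F = ((rho + sigma)%:~R)%:E /\
    bracket F (lead d P) = lead d P /\
    bracket (lead d G0) (lead d P) * F = lead d G0 * lead d P /\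
    (in_Kxy P -> in_Kxy Q -> in_Kxy F) /\
    (aligned (st d P) (st d F) \/ st d F = (1, 1)) /\
    (aligned (en d P) (en d F) \/ en d F = (1, 1)) /\
    (~ aligned (st d P) (1, 1) /\ ~ aligned (1, 1) (en d P)) /\
    (forall i : nat, (1 <= i)%N ->
                 bracket (lead d (iter i (fun G => bracket G P) G0))
                         (lead d P) = 0).
Proof.
move=> d; set M := @laurent_model K l.
case: PQ_unit => c c0 PQ; have d0 : 0 < d.1 + d.2 by case: rs_pos.
have dn := dir_neq0 d0.
have l0' : 0 < (l%:R : rat) by rewrite ltr0n.
have lE : l%:Z%:~R = l%:R :> rat by [].
have P0 : P != 0 by apply: contraTneq vP_gt0 => ->; rewrite vdeg0.
have [vp [p tP]] := tops_ex (M := M) d P0.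
have [lP vP] := tops_lead l_gt0 tP.
have vp0 : 0 < vp.
  by move: vP_gt0; rewrite vP lte_fin pmulr_lgt0 ?invr_gt0 // ltr0z.
have [t [g [v [F [tg [hF F0 Fp FE] Gi]]]]] :=
  leading_F (M := M) charK l_gt0 d0 vp0 tP c0 PQ.
have [lG _] := tops_lead l_gt0 tg.
have [lF vF] := tops_lead l_gt0 (tops_id hF F0).
have [hP p0 _] := tP.
exists (ev (M := M) P Q t), F.
(* The two opposite normals of [d] select the two ends of a leading form: [D1] serves [st], and [D2]
   serves [en]. *)
have D1 : det2 d (d.2, - d.1) != 0.
  by have := det2_orth dn; rewrite /det2 /orth /=; lia.
have D2 := det2_orth dn.
have [m1 [m1p m1v tm1]] := extreme (M := M) l_gt0 D1 hP p0.
have [m2 [m2p m2v tm2]] := extreme (M := M) l_gt0 D2 hP p0.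
have [u1 [u1p u1v tu1]] := extreme (M := M) l_gt0 D1 hF F0.
have [u2 [u2p u2v tu2]] := extreme (M := M) l_gt0 D2 hF F0.
have vpn : vp != 0 by rewrite gt_eqF.
have [c1 n1] := extreme_F (M := M) charK l_gt0 dn vpn m1v u1v u1p m1p tu1 tm1 Fp.
have [c2 n2] := extreme_F (M := M) charK l_gt0 dn vpn m2v u2v u2p m2p tu2 tm2 Fp.
have stP := @st_en_extreme K l d P m1 m2 _ _ l_gt0 dn P0 m1p m2p.
rewrite lP in stP; have {stP}[-> ->] := stP tm1 tm2.
have stF := @st_en_extreme K l d F u1 u2 _ _ l_gt0 dn F0 u1p u2p.
rewrite lF in stF; have {stF}[-> ->] := stF tu1 tu2.
have cE m n : cross (expo l m) (expo l n) = (crossm m n)%:~R / l%:R.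
  rewrite /cross /crossm /= rmorphB !rmorphM /= -!pmulrn.
  by field; rewrite pnatr_eq0 -lt0n.
have e11 : (1, 1) = expo l (l%:Z, 1%N).
  have e : (l%:R / l%:R : rat) = 1 by exact: divff (lt0r_neq0 l0').
  by rewrite /expo [(_, _).1]/= lE e.
have alE m n : aligned (expo l m) (expo l n) <-> crossm m n = 0.
  rewrite /aligned cE; split=> [/eqP|->]; last by rewrite mul0r.
  by rewrite mulf_eq0 invr_eq0 (gt_eqF l0') orbF intr_eq0 => /eqP.
rewrite lP lG e11 !alE.
split; first split.
- move=> S [S1 SL SM] SP SQ.
  have S0 : 0 \in S by have := SL (-1) 1 1 S1 S1; rewrite scaleN1r addNr.
  apply: (@ev_in K l M P Q (fun A => A \in S) t _ _ _ SP SQ) => [a|A B hA hB|A B].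
  + by have := SL a 1 0 S1 S0; rewrite addr0.
  + by have := SL 1 A B hA hB; rewrite scale1r.
  + exact: SM.
- exact: (@tops_neq0 K l M d v (ev (M := M) P Q t) g tg).
split; first exact: esym lF.
split.
  have e : (@wxy l d)%:~R = l%:R * (rho + sigma)%:~R :> rat.
    by rewrite wxyE rmorphM.
  by rewrite vF e mulrAC (divff (lt0r_neq0 l0')) mul1r.
split; first exact: Fp.
split; first exact: FE.
split.
  move=> /(in_Kxy_supported _ l_gt0) SP /(in_Kxy_supported _ l_gt0) SQ.
  apply/(in_Kxy_supported _ l_gt0).
  have Fx : supported (M := M) (fun m => 0 <= m.1) F.
    apply: (supported_nonneg charK l_gt0 d0 vp0 hP p0 hF F0 Fp).
    by apply: tops_sup tP _; apply: supW SP => m [].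
  (* Extreme monomials say nothing about the inner exponents of [F]; divisibility by [l] comes from
     [[g, p] F = g p], where [[g, p]] and [g p] have it. *)
  have Fl : supported (M := M) (fun m => (l%:Z %| m.1)%Z) F.
    pose S (m : int * nat) := (l%:Z %| m.1)%Z.
    have SD m n : S m -> S n = S (m + n) by move=> Sm; rewrite /S /= (rpredDl _ Sm).
    have Sp : supported (M := M) S p.
      by apply: tops_sup tP _; apply: supW SP => m [].
    have SM (A B : M) : supported S A -> supported S B -> supported S (A * B).
      by apply: supM => m n Sm Sn; rewrite -(SD m n).
    have Sg : supported (M := M) S g.
      apply: tops_sup tg _.
      apply: (@ev_in K l M P Q (fun A => supported (M := M) S A) t) => [a|A B|A B||].
      - by rewrite -(mon1 M) monZ; apply: sup_mon; exact: dvdz0.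
      - exact: supD.
      - exact: SM.
      - by apply: supW SP => m [].
      - by apply: supW SQ => m [].
    have Sh : supported (M := M) S (br (m0 := M) g p).
      apply: sup_br Sg Sp => m n k Sm Sn e.
      have Sl : S (l%:Z, 1%N) by exact: dvdzz.
      by rewrite (SD _ k Sl) addrC e -(SD m n).
    have h0 : br (m0 := M) g p != 0.
      have [_ g0 _] := tg; apply: contra_neq (mulm_neq0 l_gt0 g0 p0) => h0.
      by rewrite -FE h0 mul0r.
    exact: (supported_quotient l_gt0 SD h0 FE Sh (SM _ _ Sg Sp)).
  by move=> m mF; split; [exact: Fx | exact: Fl].
split; first by case: c1 => [c1|->]; [left; rewrite crossmC c1 oppr0 | right].
split; first by case: c2 => [c2|->]; [left; rewrite crossmC c2 oppr0 | right].
split; first by split; apply/eqP; [exact: n1 | rewrite crossmC oppr_eq0; exact: n2].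
move=> i i0; set Gi' := iter i _ _.
(* A vanishing iterate has no [tops]; its [lead] is 0. *)
have [->|Gn] := eqVneq Gi' 0; first by rewrite lead0; exact: (br0l (M := M)).
have [v' [g' tg']] := tops_ex (M := M) d Gn.
have [-> _] := tops_lead l_gt0 tg'.
exact: (Gi i g' v' i0 tg').
Qed.
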